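(* Let $(\Omega,\Sigma,\mu)$ be a probability space such that $L^\infty(\Omega,\mu)$ is separable, and let $P,Q$ be von Neumann algebras. Suppose $L^\infty(\Omega,\mu)\,\overline{\otimes}\,P\cong L^\infty(\Omega,\mu)\,\overline{\otimes}\,Q$ and that $P$ can be generated by $\kappa$ many elements, where $\kappa$ is an infinite cardinal. Then $Q$ can be generated by $\kappa$ many elements as well.
   Context: A von Neumann algebra is called separable if its predual is norm-separable. $\overline{\otimes}$ is the von Neumann tensor product, $\cong$ denotes isomorphism of von Neumann algebras. ''Generated by $\kappa$ many elements'' means generated as a von Neumann algebra by a subset of cardinality at most $\kappa$. *)

(* Defs.v *)
From HB Require Import structures.
From mathcomp Require Import all_boot all_order all_algebra.
From mathcomp Require Import complex.
From mathcomp Require Import all_classical all_reals all_analysis.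

Set Implicit Arguments.
Unset Strict Implicit.
Unset Printing Implicit Defensive.

Import Order.TTheory GRing.Theory Num.Theory.
Import numFieldNormedType.Exports.

Local Open Scope ring_scope.
Local Open Scope complex_scope.
Local Open Scope classical_set_scope.

(* Scalars are R[i] for R : realType; norms on
   completeNormedModType R[i] therefore take their values in R[i].
   Inner products are linear in the first variable. *)

HB.mixin Record isHilbert (R : realType) H of CompleteNormedModule R[i] H := {
  inner : {dot H for Num.conj} ;
  inner_normE : forall x : H, inner x x = `|x| ^+ 2
}.

#[short(type="hilbertType")]
HB.structure Definition Hilbert (R : realType) :=
  {H of isHilbert R H & CompleteNormedModule R[i] H}.

Definition bounded_op (R : realType) (H : hilbertType R) : set (H -> H) :=
  [set a | linear a /\ continuous a].

Definition is_adjoint (R : realType) (H : hilbertType R) (a b : H -> H) : Prop :=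
  forall x y : H, inner (a x) y = inner x (b y).

Definition commutant (R : realType) (H : hilbertType R) (S : set (H -> H)) :
    set (H -> H) :=
  [set a | bounded_op a /\ forall b, S b -> a \o b = b \o a].

(* Concrete von Neumann algebras: *-subalgebras of B(H) equal to their
   bicommutant. The last clause forces the identity of H to be in M. *)
Record is_vonNeumann (R : realType) (H : hilbertType R) (M : set (H -> H)) :
    Prop := IsVonNeumann {
  vn_bounded : M `<=` @bounded_op R H ;
  vn_add : forall a b, M a -> M b -> M (a + b) ;
  vn_scale : forall (c : R[i]) a, M a -> M (c *: a) ;
  vn_comp : forall a b, M a -> M b -> M (a \o b) ;
  vn_adjoint : forall a, M a -> exists2 b, M b & is_adjoint a b ;
  vn_bicommutant : commutant (commutant M) = M
}.

Definition vn_generated (R : realType) (H : hilbertType R) (S : set (H -> H)) :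
    set (H -> H) :=
  [set a | forall M : set (H -> H), is_vonNeumann M -> S `<=` M -> M a].

(* M is generated by a subset of cardinality at most that of the type kappa. *)
Definition generated_by (R : realType) (H : hilbertType R) (kappa : Type)
    (M : set (H -> H)) : Prop :=
  exists S : set (H -> H),
    [/\ S `<=` M, (S #<= [set: kappa])%card & vn_generated S = M].

(* No continuity is required of an isomorphism. The values of theta outside M
   are irrelevant. *)
Definition vn_isomorphic (R : realType) (H K : hilbertType R)
    (M : set (H -> H)) (N : set (K -> K)) : Prop :=
  exists theta : (H -> H) -> (K -> K),
    [/\ set_bij M N theta,
        forall a b, M a -> M b -> theta (a + b) = theta a + theta b,
        forall (c : R[i]) a, M a -> theta (c *: a) = c *: theta a,
        forall a b, M a -> M b -> theta (a \o b) = theta a \o theta b &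
        forall a b, M a -> M b -> is_adjoint a b ->
          is_adjoint (theta a) (theta b)].

(* The predual of M: restrictions to M of the functionals
   a |-> tr (u a) with u trace class, written through
   u = sum_n <., y_n> x_n with (|x_n|)_n and (|y_n|)_n square summable.
   Two functionals are identified when they agree on M. *)
Definition predual (R : realType) (H : hilbertType R) (M : set (H -> H)) :
    set ((H -> H) -> R[i]) :=
  [set phi | exists x y : nat -> H,
    [/\ cvgn (series (fun n => `|x n| ^+ 2 : R[i]^o)),
        cvgn (series (fun n => `|y n| ^+ 2 : R[i]^o)) &
        forall a, M a ->
          series (fun n => inner (a (x n)) (y n) : R[i]^o) @ \oo -->
            (phi a : R[i]^o)]].

(* A countable subset of the predual is dense for the norm
   |phi| = sup of |phi a| over the a in M of operator norm at most 1. *)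
Definition vn_separable (R : realType) (H : hilbertType R) (M : set (H -> H)) :
    Prop :=
  exists2 f : nat -> (H -> H) -> R[i],
    forall n, predual M (f n) &
    forall phi, predual M phi -> forall e : R[i], 0 < e ->
      exists n, forall a, M a -> (forall x : H, `|a x| <= `|x|) ->
        `|phi a - f n a| <= e.

Section ComplexL2.
Context (R : realType) (d : measure_display) (T : measurableType d).
Variable mu : {measure set T -> \bar R}.

Definition cLfun (p : \bar R) : set (T -> R[i]) :=
  [set f : T -> R[i] | @complex.Re R \o f \in Lfun mu p /\ @complex.Im R \o f \in Lfun mu p].

Definition cintegral (f : T -> R[i]) : R[i] :=
  (\int[mu]_x @complex.Re R (f x)) +i* (\int[mu]_x @complex.Im R (f x)).

(* The Hilbert space L^2(mu; C), up to unitary equivalence: the quotient of the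
   square integrable functions by the functions of seminorm 0, with L2_class the
   quotient map (its values on other functions are irrelevant). *)
Record L2space := L2Space {
  L2_hilbert :> hilbertType R ;
  L2_class : (T -> R[i]) -> L2_hilbert ;
  L2_class_surj : forall h, exists2 f, cLfun 2%:E f & L2_class f = h ;
  L2_class_linear : forall (c : R[i]) f g, cLfun 2%:E f -> cLfun 2%:E g ->
    L2_class (fun x => c * f x + g x) = c *: L2_class f + L2_class g ;
  L2_class_inner : forall f g, cLfun 2%:E f -> cLfun 2%:E g ->
    inner (L2_class f) (L2_class g) =
      cintegral (fun x => f x * Num.conj (g x))
}.

(* L^oo(mu) acting on L^2(mu) by multiplication. *)
Definition Linfty (L : L2space) : set (L -> L) :=
  [set m | bounded_op m /\ exists2 f, cLfun +oo%E f &
    forall g, cLfun 2%:E g -> m (L2_class L g) = L2_class L (fun x => f x * g x)].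

End ComplexL2.
Arguments Linfty {R d T mu} L.

(* The Hilbert space tensor product, up to unitary equivalence: a completion of
   the algebraic tensor product of H and K for the inner product determined on
   elementary tensors by inner_tensor. *)
Record hilbert_tensor (R : realType) (H K : hilbertType R) := HilbertTensor {
  tensor_hilbert :> hilbertType R ;
  tensor : {bilinear H -> K -> tensor_hilbert} ;
  inner_tensor : forall x x' y y',
    inner (tensor x y) (tensor x' y') = inner x x' * inner y y' ;
  tensor_dense :
    closure [set z | exists n (x : 'I_n -> H) (y : 'I_n -> K),
                       z = \sum_i tensor (x i) (y i)] = setT
}.

(* The von Neumann algebra on the tensor product space generated by the
   operators a (x) b with a in M and b in N. *)
Definition vn_tensor (R : realType) (H K : hilbertType R)
    (HK : hilbert_tensor H K) (M : set (H -> H)) (N : set (K -> K)) :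
    set (HK -> HK) :=
  vn_generated [set c : HK -> HK | bounded_op c /\
    exists a b, [/\ M a, N b &
      forall x y, c (tensor HK x y) = tensor HK (a x) (b y)]].
Arguments vn_tensor {R H K} HK M N.

(* Main.v *)
(* Write A for L^oo acting on L^2 and suppose S generates P. Separability of the
   predual yields a sequence (a_n) in A on which no difference of vector
   functionals vanishes unless it vanishes on A, so that the operators a_n (x) 1 and 1 (x) s, s in S,
   generate A (x) P.

   An isomorphism theta : M -> N maps generators of M to generators of N. For a
   vector eta the state x |-> <theta(x) eta, eta> preserves suprema of chains, and
   a maximality argument on positive operators (no spectral theorem is needed)
   produces a positive h in M and a vector xi with
   |theta(x h) eta| <= |x h xi| for all x in M and <theta(h) eta, eta> > 0.
   Hence the bounded intertwiners w from theta to the identity representation of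
   M separate the points. If t commutes with theta(D), where D'' = M, then
   w t w'^* commutes with D, thus with M, for all intertwiners w, w', and so t
   commutes with N.

   The vectors a_n 1 form a countable total set X in L^2. If Q0 is the algebra
   generated by the slices (omega_{xi,eta} (x) id)(x), for xi, eta in X and x in a
   generating set of A (x) Q, then 1 (x) q' commutes with A (x) Q for every q' in
   the commutant of Q0, so that every q in Q is in Q0'' = Q0. There are at most
   kappa * aleph_0 = kappa such slices. *)

(* Since [vn_isomorphic] asks for no continuity, the image of a generating set cannot be treated by
   closing it up in a weak topology. What an isomorphism preserves for purely algebraic reasons is
   positivity, positive elements being squares of self-adjoint ones; hence it preserves order, and
   suprema of chains because its inverse preserves order too. Zorn's lemma asks for no more than
   chains. Even so, the elements of M sent into a given von Neumann algebra form a set that is not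
   visibly its own bicommutant. Intertwiners move the question to H, where the bicommutant is known,
   and spare the structure theory of normal homomorphisms. Membership in a von Neumann algebra is
   tested against its commutant throughout, so no density theorem for operator algebras is used, and
   of the commutation theorem for tensor products only the elementary inclusion occurs. Separability
   acts twice, for the generators of the tensor product and for the slices, and the same sequence
   (a_n) serves both times. *)
Require Import Defs.
From HB Require Import structures.
From mathcomp Require Import all_boot all_order all_algebra.
From mathcomp Require Import complex.
From mathcomp Require Import all_classical all_reals all_analysis.
From mathcomp Require Import ess_sup_inf measurable_realfun.
From mathcomp Require Import ring lra.

Set Implicit Arguments.
Unset Strict Implicit.
Unset Printing Implicit Defensive.

Import Order.TTheory GRing.Theory Num.Theory.
Import numFieldNormedType.Exports.

Local Open Scope ring_scope.
Local Open Scope complex_scope.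
Local Open Scope classical_set_scope.

(** * The real inner product and completeness *)

Section RealInner.
Variables (R : realType).
Implicit Types H K : hilbertType R.

Lemma innerDl H (x y z : H) : inner (x + y) z = inner x z + inner y z.
Proof. by rewrite linearDl. Qed.
Lemma innerDr H (x y z : H) : inner z (x + y) = inner z x + inner z y.
Proof. by rewrite linearDr. Qed.
Lemma innerZl H (c : R[i]) (x y : H) : inner (c *: x) y = c * inner x y.
Proof. by rewrite linearZl_LR. Qed.
Lemma innerZr H (c : R[i]) (x y : H) : inner x (c *: y) = Num.conj c * inner x y.
Proof. by rewrite linearZr_LR. Qed.
Lemma innerNl H (x y : H) : inner (- x) y = - inner x y.
Proof. by rewrite linearNl. Qed.
Lemma innerNr H (x y : H) : inner x (- y) = - inner x y.
Proof. by rewrite linearNr. Qed.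
Lemma innerBl H (x y z : H) : inner (x - y) z = inner x z - inner y z.
Proof. by rewrite linearBl. Qed.
Lemma innerBr H (x y z : H) : inner z (x - y) = inner z x - inner z y.
Proof. by rewrite linearBr. Qed.
Lemma inner0l H (x : H) : inner 0 x = 0.
Proof. by rewrite linear0l. Qed.
Lemma inner0r H (x : H) : inner x 0 = 0.
Proof. by rewrite linear0r. Qed.
Lemma innerC H (x y : H) : inner y x = Num.conj (inner x y).
Proof. by rewrite hermC expr0 mul1r. Qed.
Lemma inner_suml H n (f : 'I_n -> H) y :
  inner (\sum_i f i) y = \sum_i inner (f i) y.
Proof. by rewrite linear_sumlz. Qed.
(* The norm of H takes its values in R[i]; real parts and squared norms make the
   linear and nonlinear arithmetic tactics of R available. *)
Definition rp H (x y : H) : R := complex.Re (inner x y).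
Definition nn H (x : H) : R := rp x x.

Lemma rpDl H (x y z : H) : rp (x + y) z = rp x z + rp y z.
Proof. by rewrite /rp innerDl raddfD. Qed.
Lemma rpDr H (x y z : H) : rp z (x + y) = rp z x + rp z y.
Proof. by rewrite /rp innerDr raddfD. Qed.
Lemma rpNl H (x y : H) : rp (- x) y = - rp x y.
Proof. by rewrite /rp innerNl raddfN. Qed.
Lemma rpNr H (x y : H) : rp x (- y) = - rp x y.
Proof. by rewrite /rp innerNr raddfN. Qed.
Lemma rp0l H (x : H) : rp 0 x = 0.
Proof. by rewrite /rp inner0l. Qed.
Lemma rp0r H (x : H) : rp x 0 = 0.
Proof. by rewrite /rp inner0r. Qed.
Lemma rpC H (x y : H) : rp x y = rp y x.
Proof. by rewrite /rp innerC; case: (inner y x). Qed.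
Lemma rpZl H (c : R) (x y : H) : rp (c%:C *: x) y = c * rp x y.
Proof. by rewrite /rp innerZl; case: (inner x y) => a b /=; rewrite mul0r subr0. Qed.
Lemma rpZr H (c : R) (x y : H) : rp x (c%:C *: y) = c * rp x y.
Proof. by rewrite rpC rpZl rpC. Qed.

Definition rpE := (rpDl, rpDr, rpNl, rpNr, rpZl, rpZr, rp0l, rp0r).

Lemma inner_rp H (x y : H) : inner x y = rp x y +i* rp x ('i *: y).
Proof.
by rewrite /rp innerZr; case: (inner x y) => a b /=; congr (_ +i* _); ring.
Qed.

Lemma inner_nn H (x : H) : inner x x = (nn x)%:C.
Proof.
rewrite /nn /rp inner_normE.
have : (`|x| ^+ 2 : R[i]) \is Num.real by rewrite realE exprn_ge0.
by move=> /RRe_real ->.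
Qed.

Lemma nn_ge0 H (x : H) : 0 <= nn x.
Proof. by rewrite -lecR -inner_nn dnorm_ge0. Qed.

Lemma nn_eq0 H (x : H) : nn x = 0 -> x = 0.
Proof.
by move=> h; apply/eqP; rewrite -(dnorm_eq0 inner) inner_nn h.
Qed.

Lemma nn0 H : nn (0 : H) = 0.
Proof. by rewrite /nn rp0l. Qed.

Lemma nnZ H (c : R[i]) (x : H) :
  nn (c *: x) = (complex.Re c ^+ 2 + complex.Im c ^+ 2) * nn x.
Proof.
rewrite /nn /rp innerZl innerZr inner_nn.
by case: c => a b /=; ring.
Qed.

Lemma nnN H (x : H) : nn (- x) = nn x.
Proof. by rewrite /nn !rpE opprK. Qed.

Lemma nnD H (x y : H) : nn (x + y) = nn x + nn y + 2 * rp x y.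
Proof. by rewrite /nn !rpE (rpC y x); ring. Qed.

Lemma nnB H (x y : H) : nn (x - y) = nn x + nn y - 2 * rp x y.
Proof. by rewrite /nn !rpE (rpC y x); ring. Qed.

Lemma nnBC H (x y : H) : nn (x - y) = nn (y - x).
Proof. by rewrite -opprB nnN. Qed.

Lemma nnD_le H (x y : H) : nn (x + y) <= 2 * nn x + 2 * nn y.
Proof. by have := nn_ge0 (x - y); rewrite nnB nnD; lra. Qed.

Lemma nn_tri H (x y z : H) : nn (x - z) <= 2 * nn (x - y) + 2 * nn (y - z).
Proof. by have := nnD_le (x - y) (y - z); rewrite addrA subrK. Qed.

Lemma rp_cs H (x y : H) : rp x y ^+ 2 <= nn x * nn y.
Proof.
have [y0|y0] := eqVneq (nn y) 0.
  by rewrite (nn_eq0 y0) rp0r nn0 mulr0 expr0n.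
have yp : 0 < nn y by rewrite lt_neqAle eq_sym y0 nn_ge0.
have := nn_ge0 ((nn y)%:C *: x - (rp x y)%:C *: y).
rewrite nnB !nnZ /= !rpE.
have -> : (nn y ^+ 2 + 0 ^+ 2) * nn x + (rp x y ^+ 2 + 0 ^+ 2) * nn y -
   2 * (nn y * (rp x y * rp x y)) = nn y * (nn x * nn y - rp x y ^+ 2) by ring.
by rewrite pmulr_rge0 // subr_ge0.
Qed.

Lemma rp_amgm H (x y : H) (t : R) : 0 < t ->
  2 * `|rp x y| <= t * nn x + t^-1 * nn y.
Proof.
move=> t0.
have t1 : t^-1 * t = 1 by rewrite mulVf // gt_eqF.
have k s : s ^+ 2 = 1 -> 2 * (s * rp x y) <= t * nn x + t^-1 * nn y.
  move=> s1; have := nn_ge0 (t%:C *: x - s%:C *: y).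
  rewrite nnB !nnZ /= !rpE s1 => h.
  have : 0 <= t^-1 * ((t ^+ 2 + 0 ^+ 2) * nn x + (1 + 0 ^+ 2) * nn y
     - 2 * (t * (s * rp x y))).
    by rewrite mulr_ge0 // ltW // invr_gt0.
  have -> : t^-1 * ((t ^+ 2 + 0 ^+ 2) * nn x + (1 + 0 ^+ 2) * nn y -
     2 * (t * (s * rp x y))) = (t^-1 * t) * t * nn x + t^-1 * nn y -
     2 * (t^-1 * t) * (s * rp x y) by ring.
  by rewrite t1; lra.
have [h|h] := leP 0 (rp x y).
  by rewrite ger0_norm // -[rp x y]mul1r; apply: k; rewrite expr1n.
by rewrite ltr0_norm // -mulN1r; apply: k; rewrite sqrrN expr1n.
Qed.

Lemma inner_ext H (x y : H) : (forall z, inner x z = inner y z) -> x = y.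
Proof.
move=> h; apply/eqP; rewrite -subr_eq0; apply/eqP/nn_eq0.
by rewrite /nn /rp innerBl h subrr.
Qed.

Lemma inner_eq0C H (x y : H) : inner x y = 0 -> inner y x = 0.
Proof. by move=> h; rewrite innerC h conjC0. Qed.

Lemma inner_eq0_rp H (x : H) (V : set H) : (forall c v, V v -> V (c *: v)) ->
  (forall v, V v -> rp v x = 0) -> forall v, V v -> inner v x = 0.
Proof.
move=> VZ h v Vv; apply: inner_eq0C; rewrite inner_rp (rpC x v) h //.
by rewrite (rpC x) h //; exact: VZ.
Qed.

Lemma norm_nn H (x : H) : `|x| ^+ 2 = (nn x)%:C.
Proof. by rewrite -inner_normE inner_nn. Qed.

Lemma nn_lt_norm H (x : H) (e : R) : 0 < e -> (nn x < e ^+ 2) = (`|x| < e%:C).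
Proof.
move=> e0; rewrite -ltcR -norm_nn rmorphXn /= ltr_pXn2r // nnegrE //.
by rewrite lecR ltW.
Qed.

Definition nncvg H (u : nat -> H) (l : H) := forall e : R, 0 < e ->
  exists N, forall n, (N <= n)%N -> nn (u n - l) <= e.

Lemma nn_complete H (u : nat -> H) :
  (forall e : R, 0 < e -> exists N, forall m n, (N <= m)%N -> (N <= n)%N ->
     nn (u m - u n) <= e) -> exists l, nncvg u l.
Proof.
move=> hC.
have hc : cauchy (u @ \oo).
  apply/cauchy_exP => e e0.
  have eR : e = (complex.Re e)%:C by rewrite RRe_real // realE ltW.
  have e0' : 0 < complex.Re e by rewrite -ltcR -eR.
  have e2 : 0 < (complex.Re e) ^+ 2 / 2 by rewrite divr_gt0 // exprn_gt0.
  have [N hN] := hC _ e2.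
  exists (u N); exists N => // n /= Nn.
  rewrite /= -ball_normE /ball_ /= eR -nn_lt_norm //.
  apply: (@le_lt_trans _ _ (complex.Re e ^+ 2 / 2)); first exact: hN.
  by rewrite ltr_pdivrMr // ltr_pMr ?exprn_gt0 // ltr1n.
have /cvg_ex [l hl] : cvgn u by apply: cauchy_cvg.
exists l => e e0.
set e' := Num.sqrt e.
have e'0 : 0 < e' by rewrite sqrtr_gt0.
have e'E : e' ^+ 2 = e by rewrite sqr_sqrtr // ltW.
have : 0 < e'%:C by rewrite ltcR.
move=> /(((cvgrPdist_lt _ _).1 hl) _) [N _ hN].
exists N => n Nn; have := hN n Nn.
by rewrite -nn_lt_norm // e'E nnBC => /ltW.
Qed.

Lemma nncvg_unique H (u : nat -> H) l l' : nncvg u l -> nncvg u l' -> l = l'.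
Proof.
move=> h h'; apply/eqP; rewrite -subr_eq0; apply/eqP/nn_eq0/eqP.
rewrite eq_le nn_ge0 andbT; apply/ler_addgt0Pl => e e0; rewrite addr0.
have e4 : 0 < e / 4 by rewrite divr_gt0.
have [N hN] := h _ e4; have [N' hN'] := h' _ e4.
have := hN (maxn N N') (leq_maxl _ _); have := hN' (maxn N N') (leq_maxr _ _).
have := nn_tri l (u (maxn N N')) l'; rewrite (nnBC l (u _)); lra.
Qed.

(** The bound concerns squared norms, so it lives in R; source and target may differ, as
    intertwiners and the maps x |-> x (x) k require. *)
Definition bop H K (a : H -> K) : Prop :=
  linear a /\ exists2 C : R, 0 <= C & forall x, nn (a x) <= C * nn x.

Lemma bop_bounded_op H (a : H -> H) : bounded_op a <-> bop a.
Proof.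
split=> [[la ca]|[la [C C0 hC]]]; split=> //.
  pose aL := GRing.isLinear.Build _ _ _ _ a la.
  pose f : {linear H -> H} := HB.pack a aL.
  have /linear_boundedP [M [MR hM]] : bounded_near f (nbhs (0 : H)).
    by apply/linear_bounded_continuous.
  set r := `|M| + 1.
  have r0 : 0 <= r by rewrite addr_ge0.
  have hr x : `|a x| <= r * `|x|.
    by apply: hM; rewrite (le_lt_trans (real_ler_norm MR)) // ltrDl.
  exists ((complex.Re r) ^+ 2); first exact: sqr_ge0.
  have rR : r = (complex.Re r)%:C by rewrite RRe_real // realE r0.
  move=> x; rewrite -lecR -norm_nn rmorphM /= -norm_nn rmorphXn /= -rR -exprMn.
  by rewrite ler_sqr ?nnegrE ?mulr_ge0 //; exact: hr.
pose aL := GRing.isLinear.Build _ _ _ _ a la.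
pose f : {linear H -> H} := HB.pack a aL.
apply: (@linear_bounded_continuous _ _ _ f).1.
apply/linear_boundedP; exists (Num.sqrt C)%:C; split.
  by rewrite realE lecR sqrtr_ge0.
move=> r /ltW rC x; apply: (@le_trans _ _ ((Num.sqrt C)%:C * `|x|)); last first.
  by rewrite ler_wpM2r.
rewrite -ler_sqr ?nnegrE ?mulr_ge0 ?lecR ?sqrtr_ge0 //.
rewrite norm_nn exprMn norm_nn -rmorphXn /= sqr_sqrtr // -rmorphM lecR.
exact: hC.
Qed.

End RealInner.

(** * Riesz representation and operators given by a graph *)

Section Riesz.
Variables (R : realType).
Implicit Types H K : hilbertType R.

(** At t = - b / (n + 1) the quadratic is negative unless b = 0; the shift by 1 covers n = 0. *)
Lemma quad_ge0_eq0 (b n : R) : 0 <= n ->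
  (forall t, 0 <= 2 * t * b + t ^+ 2 * n) -> b = 0.
Proof.
move=> n0 h.
have n1 : 0 < n + 1 by lra.
have := h (- b / (n + 1)).
have -> : 2 * (- b / (n + 1)) * b + (- b / (n + 1)) ^+ 2 * n =
   - (b ^+ 2 * ((n + 2) / (n + 1) ^+ 2)) by field; rewrite gt_eqF.
rewrite oppr_ge0 pmulr_lle0; last by rewrite divr_gt0 ?exprn_gt0 //; lra.
by move=> h'; apply/eqP; rewrite -sqrf_eq0 eq_le h' sqr_ge0.
Qed.

Lemma invn_le (e : R) : 0 < e ->
  exists N, forall n, (N <= n)%N -> (n.+1%:R^-1 : R) <= e.
Proof.
move=> e0; have [N _ hN] := near_infty_natSinv_lt (PosNum e0).
by exists N => n Nn; apply/ltW/hN.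
Qed.

Lemma rp_nncvg H (u : nat -> H) l v : nncvg u l -> forall e : R, 0 < e ->
  exists N, forall n, (N <= n)%N -> `|rp (u n) v - rp l v| <= e.
Proof.
move=> ul e e0.
have v1 : 0 < nn v + 1 by have := nn_ge0 v; lra.
have [N hN] := ul _ (divr_gt0 (exprn_gt0 2 e0) v1).
exists N => n /hN; rewrite ler_pdivlMr // => h.
have e0' := ltW e0.
rewrite -rpNl -rpDl -(@ler_pXn2r _ 2) ?nnegrE //.
rewrite real_normK ?num_real //.
apply: le_trans (rp_cs _ _) _; apply: le_trans h.
by rewrite ler_wpM2l ?nn_ge0 // lerDl.
Qed.

(** [V] is the graph of a functional on a subspace that may be neither closed nor dense; the bound
    makes it single valued. The second clause puts [l] in the closure of the domain, which makes [l]
    unique. *)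
Lemma riesz H (V : set (H * R[i])) (C : R) :
  0 <= C -> V (0, 0) ->
  (forall c p q, V p -> V q -> V (c *: p.1 + q.1, c * p.2 + q.2)) ->
  (forall p, V p -> complex.Re p.2 ^+ 2 <= C * nn p.1) ->
  exists l, [/\ forall p, V p -> p.2 = inner p.1 l,
    forall x, (forall p, V p -> inner p.1 x = 0) -> inner l x = 0 &
    nn l <= C].
Proof.
move=> C0 V0 VP VC.
(* The representing vector minimises nn u - 2 Re c over the pairs (u, c) in V. *)
pose J (p : H * R[i]) : R := nn p.1 - 2 * complex.Re p.2.
have JC p : V p -> - C <= J p.
  move=> /VC h; rewrite /J.
  have : 2 * complex.Re p.2 <= nn p.1 + C; last by lra.
  have [h0|h0] := leP (complex.Re p.2) 0.
    by have := nn_ge0 p.1; lra.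
  rewrite -ler_sqr ?nnegrE; last 2 first.
  - by lra.
  - by have := nn_ge0 p.1; lra.
  by have := sqr_ge0 (nn p.1 - C); nra.
pose E := [set J p | p in V].
have Einf : has_inf E.
  split; first by exists (J (0, 0)), (0, 0).
  by exists (- C) => _ [p Vp <-]; exact: JC.
pose m := inf E.
have mJ p : V p -> m <= J p.
  by move=> Vp; apply: ge_inf; [case: Einf|exists p].
have /choice [p hp] : forall n : nat, exists p, V p /\ J p < m + n.+1%:R^-1.
  move=> n.
  have n0 : 0 < (n.+1%:R^-1 : R) by rewrite invr_gt0.
  by have [_ [p Vp <-] h] := inf_adherent n0 Einf; exists p.
have Vp n : V (p n) by case: (hp n).
have Jp n : J (p n) < m + n.+1%:R^-1 by case: (hp n).
have VD c q q' : V q -> V q' -> V (c *: q.1 + q'.1, c * q.2 + q'.2) by exact: VP.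
have VZ c q : V q -> V (c *: q.1, c * q.2).
  by move=> Vq; have := VP c _ _ Vq V0; rewrite /= !addr0.
have [l hl] : exists l, nncvg (fun n => (p n).1) l.
  apply: nn_complete => e e0.
  have e4 : 0 < e / 4 by rewrite divr_gt0.
  have [N hN] := invn_le e4.
  exists N => i j iN jN.
  (* The midpoint of two almost minimal pairs is in [V], so the parallelogram law bounds the squared
     distance by twice the sum of the two errors. *)
  have := mJ _ (VZ (2^-1)%:C _ (VD 1 _ _ (Vp i) (Vp j))).
  have := Jp i; have := Jp j; have := hN i iN; have := hN j jN.
  rewrite /J nnZ /= !scale1r !mul1r nnB nnD.
  case: (p i) => ui [ri si]; case: (p j) => uj [rj sj] /=.
  move: j.+1%:R^-1 i.+1%:R^-1 => x y.
  lra.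
have lE q : V q -> complex.Re q.2 = rp q.1 l.
  move=> Vq; apply/eqP; rewrite -subr_eq0 -oppr_eq0 opprB; apply/eqP.
  (* First variation: the minimising sequence is perturbed by t times q, and the limit gives the
     quadratic inequality. *)
  apply: (@quad_ge0_eq0 _ (nn q.1)) => [|t]; first exact: nn_ge0.
  apply/ler_addgt0Pl => e e0.
  have e2 : 0 < e / (4 * (`|t| + 1)).
    by rewrite divr_gt0 // mulr_gt0 // ltr_wpDl.
  have e1 : 0 < e / 2 by rewrite divr_gt0.
  have [N hN] := invn_le e1.
  have [N' hN'] := rp_nncvg q.1 hl e2.
  have := hN _ (leq_maxl N N'); have := hN' _ (leq_maxr N N').
  set n := maxn N N' => h1 h2.
  have := mJ _ (VD t%:C _ _ Vq (Vp n)); have := Jp n.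
  rewrite /J /= nnD nnZ !rpE.
  have : `|2 * t * (rp (p n).1 q.1 - rp l q.1)| <= e / 2.
    move: h1; rewrite ler_pdivlMr; last by rewrite mulr_gt0 // ltr_wpDl.
    rewrite !normrM (ger0_norm (ler0n _ 2)).
    have := mulr_ge0 (normr_ge0 t) (normr_ge0 (rp (p n).1 q.1 - rp l q.1)).
    by have := normr_ge0 (rp (p n).1 q.1 - rp l q.1); lra.
  rewrite (rpC q.1 (p n).1) (rpC q.1 l).
  case: (q) => u [r s] /=; case: (p n) => un [rn sn] /=.
  rewrite ler_norml => /andP[h3 h4] h5 h6.
  move: h1 h2 h5; move: n.+1%:R^-1 => z h1 h2 h5.
  lra.
have orth x : (forall q, V q -> inner q.1 x = 0) -> inner l x = 0.
  move=> hx; apply: inner_eq0C.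
  pose W := [set c *: x | c in [set: R[i]]].
  have Wl v : W v -> rp v l = 0.
    move=> [c _ <-]; rewrite rpC; apply/eqP; rewrite -normr_eq0 eq_le normr_ge0.
    rewrite andbT; apply/ler_addgt0Pl => e e0; rewrite addr0.
    have [N hN] := rp_nncvg (c *: x) hl e0.
    have uE : rp (p N).1 (c *: x) = 0 by rewrite /rp innerZr hx // mulr0.
    by have := hN _ (leqnn N); rewrite uE sub0r normrN.
  apply: (@inner_eq0_rp _ _ l W _ Wl) => [c _ [d _ <-]|].
    by exists (c * d) => //; rewrite scalerA.
  by exists 1 => //; rewrite scale1r.
exists l; split=> // [q Vq|].
  have := lE _ (VZ 'i _ Vq); have := lE _ Vq; rewrite /rp /= innerZl.
  case: (inner q.1 l) => a b /=; case: (q.2) => c d /= h1 h2.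
  congr (_ +i* _); lra.
apply/ler_addgt0Pl => e e0.
have [N hN] := hl _ e0; have := hN _ (leqnn N).
have := JC _ (Vp N).
by rewrite /J nnB (lE _ (Vp N)); lra.
Qed.

(** [b k] represents the functional p |-> inner p.2 k on the graph. Its values lie in the closure of
    the domain of [G]; this uniqueness is what makes [b] linear. *)
Lemma riesz_graph H K (G : set (H * K)) (C : R) :
  0 <= C -> G (0, 0) ->
  (forall c p q, G p -> G q -> G (c *: p.1 + q.1, c *: p.2 + q.2)) ->
  (forall p, G p -> nn p.2 <= C * nn p.1) ->
  exists b : K -> H, [/\ bop b,
    forall p k, G p -> inner p.2 k = inner p.1 (b k) &
    forall x, (forall p, G p -> inner p.1 x = 0) -> forall k, inner (b k) x = 0].
Proof.
move=> C0 G0 GP GC.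
have /choice [b hb] : forall k : K, exists l : H,
    [/\ forall p, G p -> inner p.2 k = inner p.1 l,
        forall x, (forall p, G p -> inner p.1 x = 0) -> inner l x = 0 &
        nn l <= C * nn k].
  move=> k.
  pose V : set (H * R[i]) := [set (p.1, inner p.2 k) | p in G].
  have [||||l [h1 h2 h3]] := @riesz _ V (C * nn k).
  - by rewrite mulr_ge0 ?nn_ge0.
  - by exists (0, 0) => //=; rewrite inner0l.
  - move=> c _ _ [p Gp <-] [q Gq <-] /=.
    by exists (c *: p.1 + q.1, c *: p.2 + q.2); [exact: GP|rewrite /= innerDl innerZl].
  - move=> _ [p Gp <-] /=; apply: (le_trans (rp_cs _ _)).
    rewrite mulrAC mulrC [leRHS]mulrC.
    by rewrite ler_wpM2l ?nn_ge0 // GC.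
  exists l; split=> // [p Gp|x hx].
    by have := h1 (p.1, inner p.2 k); apply; exists p.
  by apply: h2 => _ [p Gp <-]; exact: hx.
have b1 k p : G p -> inner p.2 k = inner p.1 (b k) by case: (hb k) => h _ _; exact: h.
have b2 k x : (forall p, G p -> inner p.1 x = 0) -> inner (b k) x = 0.
  by case: (hb k) => _ h _; exact: h.
exists b; split; [split| |] => //.
- move=> c k k'; apply/eqP; rewrite -subr_eq0 -(dnorm_eq0 inner); apply/eqP.
  set z := _ - _.
  have hz : forall p, G p -> inner p.1 z = 0.
    move=> p Gp; rewrite /z innerBr innerDr innerZr -!b1 //.
    by rewrite innerDr innerZr subrr.
  by rewrite {1}/z innerBl innerDl innerZl !b2 // mulr0 addr0 subrr.
- by exists C => // k; case: (hb k).
- by move=> p k Gp; apply: b1.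
- by move=> x hx k; apply: b2.
Qed.

Lemma linear_fun0 H K (a : H -> K) : linear a -> a 0 = 0.
Proof. by move=> la; have := la (-1) 0 0; rewrite !scaleN1r !addNr. Qed.

Lemma bop_adj H K (a : H -> K) : bop a ->
  exists2 b : K -> H, bop b & forall x y, inner (a x) y = inner x (b y).
Proof.
move=> [la [C C0 aC]].
have [|c p q Gp Gq|p Gp|b [bb b1 _]] :=
    @riesz_graph _ _ [set p : H * K | a p.1 = p.2] C C0.
- exact: linear_fun0 la.
- by rewrite /= la Gp Gq.
- by rewrite -Gp.
by exists b => // x y; rewrite -(b1 (x, a x) y).
Qed.

(** Taking the adjoint twice extends a bounded operator from its domain without any limit, by 0 on
    the orthogonal complement. *)
Lemma graph_op H K (G : set (H * K)) (C : R) :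
  0 <= C -> G (0, 0) ->
  (forall c p q, G p -> G q -> G (c *: p.1 + q.1, c *: p.2 + q.2)) ->
  (forall p, G p -> nn p.2 <= C * nn p.1) ->
  exists a b, [/\ bop a, bop b, forall x y, inner (a x) y = inner x (b y),
    forall p, G p -> a p.1 = p.2 &
    forall x, (forall p, G p -> inner p.1 x = 0) -> a x = 0].
Proof.
move=> C0 G0 GP GC.
have [b [bb b1 b2]] := riesz_graph C0 G0 GP GC.
have [a ba ab] := bop_adj bb.
exists a, b; split=> //.
- by move=> x y; rewrite innerC -ab -innerC.
- move=> p Gp; apply: inner_ext => z.
  by rewrite innerC -ab -innerC (b1 p).
- move=> x hx; apply: inner_ext => z.
  by rewrite innerC -ab b2 // conjC0 inner0l.
Qed.
End Riesz.

(** * Bounded operators and monotone limits *)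

Section BoundedOperators.
Variables (R : realType).
Implicit Types H K G : hilbertType R.

Definition adj H K (a : H -> K) (b : K -> H) :=
  forall x y, inner (a x) y = inner x (b y).

Lemma adj_sym H K (a : H -> K) b : adj a b -> adj b a.
Proof. by move=> h x y; rewrite innerC -h -innerC. Qed.

Lemma adj_rp H K (a : H -> K) b x y : adj a b -> rp (a x) y = rp x (b y).
Proof. by move=> h; rewrite /rp h. Qed.

Lemma adj_linear H K (a : H -> K) b : adj a b -> linear a.
Proof.
move=> h c x y; apply: inner_ext => z.
by rewrite innerDl innerZl !h innerDl innerZl.
Qed.

Lemma adj_comp H K G (a : H -> K) b (a' : K -> G) b' :
  adj a b -> adj a' b' -> adj (a' \o a) (b \o b').
Proof. by move=> h h' x y /=; rewrite h' h. Qed.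

Lemma adj_unique H K (a : H -> K) b b' : adj a b -> adj a b' -> b = b'.
Proof.
move=> h h'; apply/funext => y; apply: inner_ext => z.
by rewrite innerC -h h' -innerC.
Qed.

Lemma bopD H K (a : H -> K) x y : bop a -> a (x + y) = a x + a y.
Proof. by case=> la _; have := la 1 x y; rewrite !scale1r. Qed.

Lemma bopZ H K (a : H -> K) c x : bop a -> a (c *: x) = c *: a x.
Proof. by move=> ba; have [la _] := ba; have := la c x 0; rewrite (linear_fun0 la) !addr0. Qed.

Lemma bopN H K (a : H -> K) x : bop a -> a (- x) = - a x.
Proof. by move=> ba; rewrite -scaleN1r bopZ // scaleN1r. Qed.

Lemma bopB H K (a : H -> K) x y : bop a -> a (x - y) = a x - a y.
Proof. by move=> ba; rewrite bopD // bopN. Qed.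

Lemma bop_id H : bop (@id H).
Proof. by split=> //; exists 1 => // x; rewrite mul1r. Qed.

Lemma bop_comp H K G (a : H -> K) (b : K -> G) : bop a -> bop b -> bop (b \o a).
Proof.
move=> [la [C C0 hC]] [lb [D D0 hD]]; split=> [c x y /=|].
  by rewrite la lb.
exists (D * C); first exact: mulr_ge0.
move=> x /=; apply: (le_trans (hD _)).
by rewrite -mulrA ler_wpM2l.
Qed.

Lemma bop_add H K (a b : H -> K) : bop a -> bop b -> bop (a + b).
Proof.
move=> [la [C C0 hC]] [lb [D D0 hD]]; split=> [c x y /=|].
  by rewrite !fctE la lb scalerDr addrACA.
exists (2 * C + 2 * D); first lra.
move=> x; rewrite fctE; apply: (le_trans (nnD_le _ _)).
by have := hC x; have := hD x; lra.
Qed.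

Lemma bop_scale H K (c : R[i]) (a : H -> K) : bop a -> bop (c *: a).
Proof.
move=> [la [C C0 hC]]; split=> [d x y /=|].
  by rewrite !fctE la scalerDr !scalerA mulrC.
exists ((complex.Re c ^+ 2 + complex.Im c ^+ 2) * C).
  by rewrite mulr_ge0 // addr_ge0 // sqr_ge0.
move=> x; rewrite fctE nnZ -mulrA ler_wpM2l //.
by rewrite addr_ge0 // sqr_ge0.
Qed.

Lemma bop_sub H K (a b : H -> K) : bop a -> bop b -> bop (a - b).
Proof. by move=> ba bb; rewrite -scaleN1r; apply: bop_add => //; exact: bop_scale. Qed.

Lemma nncvg_bop H K (a : H -> K) u l : bop a -> nncvg u l ->
  nncvg (a \o u) (a l).
Proof.
move=> ba ul e e0; have [_ [C C0 hC]] := ba.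
have C1 : 0 < C + 1 by lra.
have [N hN] := ul _ (divr_gt0 e0 C1).
exists N => n /hN; rewrite ler_pdivlMr // /= -bopB // => h.
apply: (le_trans (hC _)); have := nn_ge0 (u n - l); nra.
Qed.

Lemma nncvg_add H (u v : nat -> H) l m : nncvg u l -> nncvg v m ->
  nncvg (fun n => u n + v n) (l + m).
Proof.
move=> ul vm e e0; have e4 : 0 < e / 4 by rewrite divr_gt0.
have [N hN] := ul _ e4; have [N' hN'] := vm _ e4.
exists (maxn N N') => n; rewrite geq_max => /andP[/hN h /hN' h'].
have := nnD_le (u n - l) (v n - m); rewrite addrACA -opprD.
lra.
Qed.

Lemma nncvg_scale H (c : R[i]) (u : nat -> H) l : nncvg u l ->
  nncvg (fun n => c *: u n) (c *: l).
Proof. by apply: (nncvg_bop (bop_scale c (bop_id H))). Qed.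

Lemma nncvg_cst H (l : H) : nncvg (fun=> l) l.
Proof. by move=> e e0; exists 0%N => n _; rewrite subrr nn0 ltW. Qed.

Lemma rp_lim_eq H K (u : nat -> H) l y (w : nat -> K) m x :
  nncvg u l -> nncvg w m -> (forall n, rp (u n) y = rp x (w n)) ->
  rp l y = rp x m.
Proof.
move=> ul wm h; apply/eqP; rewrite -subr_eq0 -normr_eq0 eq_le normr_ge0 andbT.
apply/ler_addgt0Pl => e e0; rewrite addr0.
have e2 : 0 < e / 2 by rewrite divr_gt0.
have [N hN] := rp_nncvg y ul e2; have [N' hN'] := rp_nncvg x wm e2.
have := hN _ (leq_maxl N N'); have := hN' _ (leq_maxr N N').
rewrite h (rpC x) !ler_norml (rpC x m) => /andP[h1 h2] /andP[h3 h4].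
by apply/andP; split; lra.
Qed.

Lemma inner_lim_eq H K (u : nat -> H) l y (w : nat -> K) m x :
  nncvg u l -> nncvg w m -> (forall n, inner (u n) y = inner x (w n)) ->
  inner l y = inner x m.
Proof.
move=> ul wm h; rewrite !inner_rp (@rp_lim_eq _ _ u l y w m x) //; last first.
  by move=> n; rewrite /rp h.
congr (_ +i* _); apply: (rp_lim_eq ul (nncvg_scale 'i wm)) => n.
by rewrite /rp !innerZr h.
Qed.

Lemma rp_lim_le H (u : nat -> H) l y (C : R) :
  nncvg u l -> (forall n, rp (u n) y <= C) -> rp l y <= C.
Proof.
move=> ul h; apply/ler_addgt0Pl => e e0.
have [N hN] := rp_nncvg y ul e0.
by have := hN _ (leqnn N); rewrite ler_norml => /andP[h1 h2]; have := h N; lra.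
Qed.

Lemma bop_sa H (a : H -> H) (C : R) :
  adj a a -> (forall x, nn (a x) <= C * nn x) -> bop a.
Proof.
move=> aa hC; split; first exact: adj_linear aa.
exists `|C|; first by [].
by move=> x; apply: (le_trans (hC x)); rewrite ler_wpM2r ?nn_ge0 // ler_norm.
Qed.

Definition effect H (a : H -> H) :=
  adj a a /\ forall x, 0 <= rp (a x) x <= nn x.

Definition qle H (a b : H -> H) := forall x, rp (a x) x <= rp (b x) x.

Lemma qle_refl H (a : H -> H) : qle a a.
Proof. by move=> x; exact: lexx. Qed.
Hint Resolve qle_refl : core.

Lemma qle_trans H (b a c : H -> H) : qle a b -> qle b c -> qle a c.
Proof. by move=> h h' x; exact: le_trans (h x) (h' x). Qed.

Lemma effect_nn H (h : H -> H) x : effect h -> nn (h x) <= rp (h x) x.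
Proof.
(* h - h^2 = h (1 - h) h + (1 - h) h (1 - h). *)
move=> [hh hle]; have lh := adj_linear hh.
have hB y z : h (y - z) = h y - h z.
  by rewrite -scaleN1r addrC lh scaleN1r addrC.
have /andP[h1 _] := hle (x - h x); have /andP[_ h2] := hle (h x).
have e : rp (h (h x)) x = nn (h x) by rewrite (adj_rp _ _ hh).
by move: h1; rewrite hB !rpE e -/(nn (h x)); lra.
Qed.

Lemma effect_contraction H (h : H -> H) x : effect h -> nn (h x) <= nn x.
Proof.
by move=> eh; have := effect_nn x eh; case: eh => _ /(_ x); lra.
Qed.

Lemma effect_bop H (h : H -> H) : effect h -> bop h.
Proof.
move=> eh; apply: (@bop_sa _ _ 1); first by case: eh.
by move=> x; rewrite mul1r; exact: effect_contraction.
Qed.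

Lemma adj_sub H K (a b : H -> K) a' b' : adj a a' -> adj b b' -> adj (a - b) (a' - b').
Proof. by move=> h h' x y; rewrite !fctE innerBl innerBr h h'. Qed.

Lemma adj_add H K (a b : H -> K) a' b' : adj a a' -> adj b b' -> adj (a + b) (a' + b').
Proof. by move=> h h' x y; rewrite !fctE innerDl innerDr h h'. Qed.

Lemma adj_scaleR H K (c : R) (a : H -> K) a' :
  adj a a' -> adj (c%:C *: a) (c%:C *: a').
Proof.
move=> h x y; rewrite !fctE innerZl innerZr h.
by rewrite conj_Creal // realE !lecR le_total.
Qed.

Lemma adj_id H : adj (@id H) id.
Proof. by []. Qed.

Lemma effect_sub H (a b : H -> H) : effect a -> effect b -> qle a b -> effect (b - a).
Proof.
move=> [aa ha] [bb hb] ab; split; first exact: adj_sub.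
move=> x; rewrite !fctE !rpE; have := ha x; have := hb x; have := ab x.
by move=> h1 /andP[h2 h3] /andP[h4 h5]; apply/andP; split; lra.
Qed.

(** * Strong limits of monotone chains of effects (Vigier's theorem) *)

Section Vigier.
Variables (H : hilbertType R) (C : set (H -> H)).
Hypothesis C0 : C !=set0.
Hypothesis Ce : forall c, C c -> effect c.
Hypothesis Ct : forall c c', C c -> C c' -> qle c c' \/ qle c' c.

(** Strong convergence of the net that [C] forms when directed by [qle]. *)
Definition chain_limit (a : H -> H) := forall x (e : R), 0 < e ->
  exists2 c, C c & forall c', C c' -> qle c c' -> nn (a x - c' x) <= e.

(** For c below c' in the chain, [effect_nn] bounds nn (c' x - c x) by the gap between the two
    quadratic forms at x. A sequence along which the forms tend to their supremum is therefore
    Cauchy at x. *)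
Lemma vigier_chain_limit : exists a, chain_limit a.
Proof.
suff /choice [a ha] : forall x, exists l, forall e : R, 0 < e ->
    exists2 c, C c & forall c', C c' -> qle c c' -> nn (l - c' x) <= e.
  by exists a => x; exact: ha.
move=> x.
pose E := [set rp (c x) x | c in C].
have Esup : has_sup E.
  split; first by case: C0 => c Cc; exists (rp (c x) x), c.
  by exists (nn x) => _ [c Cc <-]; have [_ /(_ x) /andP[]] := Ce Cc.
pose s := sup E.
have /choice [c hc] : forall n : nat, exists c, C c /\ s - n.+1%:R^-1 < rp (c x) x.
  move=> n; have n0 : 0 < (n.+1%:R^-1 : R) by rewrite invr_gt0.
  by have [_ [c Cc <-] h] := sup_adherent n0 Esup; exists c.
have Cc n : C (c n) by case: (hc n).
have key n c' : C c' -> qle (c n) c' -> nn (c n x - c' x) <= n.+1%:R^-1.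
  move=> Cc' le; have e := effect_sub (Ce (Cc n)) (Ce Cc') le.
  rewrite nnBC; apply: (le_trans (effect_nn x e)).
  rewrite !fctE !rpE.
  have : rp (c' x) x <= s by apply: sup_upper_bound => //; exists c'.
  case: (hc n) => _; move: n.+1%:R^-1 => z; lra.
have [l hl] : exists l, nncvg (fun n => c n x) l.
  apply: nn_complete => e e0; have [N hN] := invn_le e0.
  exists N => m n mN nN; have [le|le] := Ct (Cc m) (Cc n).
    by apply: le_trans (hN m mN); exact: key.
  by apply: le_trans (hN n nN); rewrite nnBC; exact: key.
exists l => e e0.
have e4 : 0 < e / 4 by rewrite divr_gt0.
have [N hN] := hl _ e4; have [N' hN'] := invn_le e4.
set n := maxn N N'.
exists (c n) => // c' Cc' le; apply: (le_trans (nn_tri _ (c n x) _)).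
have := hN n (leq_maxl _ _); have := hN' n (leq_maxr _ _); have := key n c' Cc' le.
rewrite (nnBC l); move: n.+1%:R^-1 => z; lra.
Qed.

(** The chain may have no countable cofinal subset, but an identity between finitely many vectors
    only needs a sequence converging at these. *)
Lemma chain_limit_seq a (x y z : H) : chain_limit a -> exists c : nat -> H -> H,
  [/\ forall n, C (c n), nncvg (fun n => c n x) (a x),
     nncvg (fun n => c n y) (a y) & nncvg (fun n => c n z) (a z)].
Proof.
move=> ha.
have /choice [c hc] : forall n : nat, exists c, C c /\
    forall w, w = x \/ w = y \/ w = z -> nn (c w - a w) <= n.+1%:R^-1.
  move=> n; have n0 : 0 < (n.+1%:R^-1 : R) by rewrite invr_gt0.
  have [c1 C1 h1] := ha x _ n0; have [c2 C2 h2] := ha y _ n0.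
  have [c3 C3 h3] := ha z _ n0.
  have [c4 [C4 h41 h42]] : exists c4, [/\ C c4, qle c1 c4 & qle c2 c4].
    by case: (Ct C1 C2) => h; [exists c2|exists c1]; split.
  have [c5 [C5 h54 h53]] : exists c5, [/\ C c5, qle c4 c5 & qle c3 c5].
    by case: (Ct C4 C3) => h; [exists c3|exists c4]; split.
  exists c5; split=> // w [->|[->|->]]; rewrite nnBC.
  - by apply: h1 => //; exact: qle_trans h54.
  - by apply: h2 => //; exact: qle_trans h54.
  - exact: h3.
exists c; split=> [n|||]; first by case: (hc n).
all: move=> e /invn_le [N hN]; exists N => n /hN; apply: le_trans.
all: by case: (hc n) => _ h; apply: h; first [by left|by right; left|by right; right].
Qed.

Lemma vigier : exists a, [/\ effect a, forall c, C c -> qle c a,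
  forall x k, (forall c, C c -> rp (c x) x <= k) -> rp (a x) x <= k,
  forall t, bop t -> (forall c, C c -> t \o c = c \o t) -> t \o a = a \o t &
  chain_limit a].
Proof.
have [a ha] := vigier_chain_limit.
have aa : adj a a.
  move=> x y; have [c [Cc cx cy _]] := chain_limit_seq x y y ha.
  by apply: (inner_lim_eq cx cy) => n; have [h _] := Ce (Cc n); rewrite h.
have aC c x : C c -> rp (c x) x <= rp (a x) x.
  move=> Cc; have [//|h] := leP (rp (c x) x) (rp (a x) x).
  pose e := rp (c x) x - rp (a x) x.
  (* The tolerance is such that Cauchy-Schwarz keeps the forms of [a] and [c2] at x closer than the
     gap [e], although [c2] lies above [c]. *)
  have e0 : 0 < e ^+ 2 / (2 * (nn x + 1)).
    rewrite divr_gt0 ?exprn_gt0 ?subr_gt0 // mulr_gt0 //.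
    by have := nn_ge0 x; lra.
  have [c1 C1 h1] := ha x _ e0.
  have [c2 [C2 h21 h22]] : exists c2, [/\ C c2, qle c1 c2 & qle c c2].
    by case: (Ct C1 Cc) => le; [exists c|exists c1]; split.
  have := h1 c2 C2 h21; rewrite ler_pdivlMr; last first.
    by rewrite mulr_gt0 //; have := nn_ge0 x; lra.
  have := rp_cs (a x - c2 x) x; rewrite rpDl rpNl.
  have := h22 x; rewrite /e => l1 l2 l3.
  have : (rp (c x) x - rp (a x) x) ^+ 2 <= (rp (a x) x - rp (c2 x) x) ^+ 2.
    by nra.
  have := nn_ge0 x; have := nn_ge0 (a x - c2 x).
  have : 0 < (rp (c x) x - rp (a x) x) ^+ 2 by rewrite exprn_gt0 // subr_gt0.
  move=> l4 l5 l6 l7; nra.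
have aU x k : (forall c, C c -> rp (c x) x <= k) -> rp (a x) x <= k.
  move=> h; have [c [Cc cx _ _]] := chain_limit_seq x x x ha.
  by apply: (rp_lim_le cx) => n; exact: h.
exists a; split=> //.
- split=> // x; apply/andP; split.
    case: C0 => c Cc; apply: le_trans (aC c x Cc).
    by have [_ /(_ x) /andP[]] := Ce Cc.
  by apply: aU => c Cc; have [_ /(_ x) /andP[]] := Ce Cc.
- by move=> c Cc x; exact: aC.
- move=> t bt ht; apply/funext => x /=.
  have [c [Cc cx ctx _]] := chain_limit_seq x (t x) x ha.
  have := nncvg_bop bt cx.
  have -> : t \o (fun n => c n x) = (fun n => c n (t x)).
    by apply/funext => n /=; have /funeqP/(_ x) := ht _ (Cc n).
  by move=> h; exact: nncvg_unique h ctx.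
Qed.

End Vigier.
End BoundedOperators.

(** * Square roots of positive operators *)

Section SquareRoot.
Variables (R : realType) (H : hilbertType R).
Implicit Types b : H -> H.

Lemma complex_real0 : (0 : R)%:C = 0 :> R[i]. Proof. by []. Qed.

(** Polynomials in [b] with nonnegative coefficients. For an effect [b] they are positive, and they
    are stable under composition, so monotonicity of an iteration reduces to the sign of
    coefficients. *)
Inductive ppoly b : (H -> H) -> Prop :=
| ppoly_pow k : ppoly b (iter k b)
| ppoly_add p q : ppoly b p -> ppoly b q -> ppoly b (p + q)
| ppoly_scale (c : R) p : 0 <= c -> ppoly b p -> ppoly b (c%:C *: p).

Lemma iter_adj b k : adj b b -> adj (iter k b) (iter k b).
Proof.
move=> bb; elim: k => [|k IH]; first exact: adj_id.
by move=> x y; rewrite iterS bb IH -iterSr.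
Qed.

Lemma ppoly_adj b p : adj b b -> ppoly b p -> adj p p.
Proof.
move=> bb; elim=> [k|{}p q _ ap _ aq|c {}p _ _ ap].
- exact: iter_adj.
- exact: adj_add.
- exact: adj_scaleR.
Qed.

(** An even power is b^j b^j and an odd one b^j b b^j, both visibly positive. *)
Lemma ppoly_ge0 b p x : effect b -> ppoly b p -> 0 <= rp (p x) x.
Proof.
move=> eb; have [bb hb] := eb; elim=> [k|{}p q _ hp _ hq|c {}p c0 _ hp].
- rewrite -(odd_double_half k) addnC iterD.
  set j := k./2; have jj := iter_adj j bb.
  have -> y : iter j.*2 b y = iter j b (iter j b y).
    by rewrite -iterD addnn.
  rewrite (adj_rp _ _ jj); case: (odd k) => /=; last exact: nn_ge0.
  by rewrite -iterSr iterS; case/andP: (hb (iter j b x)).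
- by rewrite fctE rpDl addr_ge0.
- by rewrite fctE rpZl mulr_ge0.
Qed.

Lemma ppoly_comp b p q : adj b b -> ppoly b p -> ppoly b q -> ppoly b (p \o q).
Proof.
move=> bb pp pq; elim: pp => [k|{}p r _ h _ h'|c {}p c0 _ h]; last 2 first.
- exact: ppoly_add h h'.
- exact: ppoly_scale c0 h.
elim: pq => [j|{}p {}q _ h _ h'|c {}p c0 _ h].
- have -> : iter k b \o iter j b = iter (k + j) b.
    by apply/funext => x; rewrite iterD.
  exact: ppoly_pow.
- have -> : iter k b \o (p + q) = (iter k b \o p) + (iter k b \o q).
    apply/funext => x; rewrite !fctE.
    have := adj_linear (iter_adj k bb) 1 (p x) (q x).
    by rewrite !scale1r.
  exact: ppoly_add.
- have -> : iter k b \o (c%:C *: p) = c%:C *: (iter k b \o p).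
    apply/funext => x; rewrite !fctE.
    have lk := adj_linear (iter_adj k bb).
    by have := lk c%:C (p x) 0; rewrite (linear_fun0 lk) !addr0.
  exact: ppoly_scale.
Qed.

(* The iteration y <- (b + y^2) / 2 increases to 1 - sqrt (1 - b). *)
Fixpoint ysqrt b n : H -> H :=
  if n is n'.+1 then (2^-1 : R)%:C *: (b + (ysqrt b n' \o ysqrt b n'))
  else (0 : R)%:C *: (@id H).

Lemma ppoly_self b : ppoly b b.
Proof. exact: (ppoly_pow b 1). Qed.

Lemma ysqrt_ppoly b n : adj b b -> ppoly b (ysqrt b n).
Proof.
move=> bb; elim: n => [|n IH] /=; first exact: ppoly_scale (lexx _) (ppoly_pow b 0).
apply: ppoly_scale; first by rewrite invr_ge0.
by apply: ppoly_add (ppoly_self b) _; exact: ppoly_comp.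
Qed.

(** With d = z - y, z^2 - y^2 = z d + d y, so each increment inherits nonnegative coefficients from
    the preceding one. *)
Lemma ysqrt_step b n : adj b b -> ppoly b (ysqrt b n.+1 - ysqrt b n).
Proof.
move=> bb; elim: n => [|n IH].
  have -> : ysqrt b 1 - ysqrt b 0 = (2^-1 : R)%:C *: (b + (ysqrt b 0 \o ysqrt b 0)).
    by apply/funext => x; rewrite /= !fctE /= complex_real0 !scale0r subr0.
  apply: ppoly_scale; first by rewrite invr_ge0.
  by apply: ppoly_add (ppoly_self b) _; apply: ppoly_comp => //; exact: ysqrt_ppoly.
set y := ysqrt b n; set z := ysqrt b n.+1; set d := z - y in IH.
have lz : linear z := adj_linear (ppoly_adj bb (ysqrt_ppoly n.+1 bb)).
have -> : ysqrt b n.+2 - z = (2^-1 : R)%:C *: ((z \o d) + (d \o y)).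
  apply/funext => x; rewrite /d !fctE /=.
  have e2 w : ysqrt b n.+2 w = (2^-1 : R)%:C *: (b w + z (z w)) by [].
  have e1 w : z w = (2^-1 : R)%:C *: (b w + y (y w)) by [].
  have e3 : z (z x - y x) = z (z x) - z (y x).
    by rewrite -scaleN1r addrC lz scaleN1r addrC.
  rewrite -[LHS]/(ysqrt b n.+2 x - z x).
  rewrite -[RHS]/((2^-1 : R)%:C *: (z (z x - y x) + (z (y x) - y (y x)))).
  rewrite e3 addrA subrK e2 [X in _ - X]e1 -scalerBr; congr (_ *: _).
  by rewrite opprD addrACA subrr add0r.
apply: ppoly_scale; first by rewrite invr_ge0.
by apply: ppoly_add; apply: ppoly_comp => //; exact: ysqrt_ppoly.
Qed.

Lemma ysqrt_effect b n : effect b -> effect (ysqrt b n).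
Proof.
move=> eb; have [bb hb] := eb; split; first exact: ppoly_adj (ysqrt_ppoly _ _).
move=> x; rewrite (ppoly_ge0 x eb (ysqrt_ppoly n bb)) /=.
have hn y : nn (ysqrt b n y) <= nn y.
  elim: n y => [|n IH] y; first by rewrite /= fctE complex_real0 scale0r nn0 nn_ge0.
  rewrite /= !fctE nnZ /=.
  have := nnD_le (b y) (ysqrt b n (ysqrt b n y)).
  have := effect_contraction y eb; have := IH y; have := IH (ysqrt b n y).
  have := nn_ge0 (b y + ysqrt b n (ysqrt b n y)).
  have -> : (2^-1 : R) ^+ 2 + 0 ^+ 2 = 1 / 4 by field.
  rewrite /=; lra.
have := rp_amgm (ysqrt b n x) x (@ltr01 R); rewrite invr1 !mul1r.
have := hn x; have := ler_norm (rp (ysqrt b n x) x).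
lra.
Qed.

(** For b = 1 - a the limit y of the iteration satisfies y = (b + y^2) / 2, that is (1 - y)^2 = a.
    Commutation with [a] passes to each iterate and then to the limit. *)
Lemma effect_sqrt (a : H -> H) : effect a -> exists x, [/\ adj x x, bop x, x \o x = a &
  forall t, bop t -> t \o a = a \o t -> t \o x = x \o t].
Proof.
move=> ea; have [aa ha] := ea.
pose b : H -> H := id - a.
have eb : effect b.
  split; first exact: adj_sub (@adj_id _ H) aa.
  by move=> x; have /andP[h1 h2] := ha x; rewrite /b !fctE !rpE -/(nn x); apply/andP; split; lra.
have [bb hb] := eb.
have mono m n : (m <= n)%N -> qle (ysqrt b m) (ysqrt b n).
  elim: n => [|n IH]; first by rewrite leqn0 => /eqP ->; exact: qle_refl.
  rewrite leq_eqVlt => /orP[/eqP -> |]; first exact: qle_refl.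
  rewrite ltnS => /IH h; apply: (qle_trans h) => x.
  by have := ppoly_ge0 x eb (ysqrt_step n bb); rewrite fctE rpDl rpNl subr_ge0.
pose C := [set ysqrt b n | n in [set: nat]].
have [||c c' [n _ <-] [m _ <-]|y [ey _ _ comm hy]] := @vigier _ _ C.
- by exists (ysqrt b 0), 0%N.
- by move=> c [n _ <-]; exact: ysqrt_effect.
- by case: (leqP n m) => h; [left|right]; apply: mono => //; exact: ltnW.
have yx x : nncvg (fun n => ysqrt b n x) (y x).
  move=> e e0; have [c [N _ <-] h] := hy x e e0.
  exists N => n Nn; rewrite nnBC; apply: h; first by exists n.
  exact: mono.
have yy x : y x = (2^-1 : R)%:C *: (b x + y (y x)).
  have h1 : nncvg (fun n => ysqrt b n (ysqrt b n x)) (y (y x)).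
    move=> e e0; have e4 : 0 < e / 4 by rewrite divr_gt0.
    have [N hN] := yx x _ e4; have [N' hN'] := yx (y x) _ e4.
    exists (maxn N N') => n; rewrite geq_max => /andP[/hN h /hN' h'].
    apply: (le_trans (nn_tri _ (ysqrt b n (y x)) _)).
    have en := ysqrt_effect n eb.
    rewrite -bopB; last exact: effect_bop.
    by have := effect_contraction (ysqrt b n x - y x) en; lra.
  have h2 := nncvg_scale (2^-1 : R)%:C (nncvg_add (nncvg_cst (b x)) h1).
  apply: nncvg_unique h2; move=> e e0; have [N hN] := yx x _ e0.
  by exists N => n Nn; apply: (hN n.+1); exact: leqW.
have byy := effect_bop ey.
exists (id - y); split.
- by apply: adj_sub; [exact: adj_id|case: ey].
- by apply: bop_sub; [exact: bop_id|].
- apply/funext => x; rewrite /= !fctE bopB //.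
  have : y x + y x = b x + y (y x).
    rewrite {1 2}yy -scalerDl -raddfD /=.
    have -> : (2^-1 + 2^-1 : R) = 1 by lra.
    by rewrite scale1r.
  rewrite /b !fctE => h.
  have -> : y (y x) = y x + y x - (x - a x) by rewrite h addrAC subrr add0r.
  have -> (u v w : H) : u - v - (v - (v + v - (u - w))) = w; last by [].
  have -> : v - (v + v - (u - w)) = (u - w) - v by rewrite opprB addrCA opprD addNKr.
  by rewrite opprB addrA subrK opprB addrC subrK.
- move=> t bt ta.
  have tb : t \o b = b \o t.
    by apply/funext => x; rewrite /= /b !fctE bopB //; have /funeqP/(_ x) /= -> := ta.
  have /(_ t bt) ty := comm.
  apply/funext => x; rewrite /= !fctE bopB //; congr (_ - _).
  have /funeqP/(_ x) : t \o y = y \o t; last by [].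
  apply: ty => c [n _ <-]; elim: n => [|n IH]; apply/funext => z /=.
    by rewrite !fctE bopZ.
  rewrite !fctE bopZ // bopD //; have /funeqP/(_ z) /= -> := tb.
  have hI w : t (ysqrt b n w) = ysqrt b n (t w) by have /funeqP/(_ w) := IH.
  by rewrite !hI.
Qed.

Definition posop (a : H -> H) := adj a a /\ forall x, 0 <= rp (a x) x.

Lemma posop_sqrt (a : H -> H) : posop a -> bop a -> exists x,
  [/\ adj x x, bop x, x \o x = a &
  forall t, bop t -> t \o a = a \o t -> t \o x = x \o t].
Proof.
move=> [aa a0] ba; have [_ [C C0 hC]] := ba.
(* [C] bounds the square of the norm; by the arithmetic-geometric mean inequality the form of [a] is
   at most (C + 1) / 2, so a / k is an effect, and k is positive even if C = 0. *)
pose k := C + 1.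
have k0 : 0 < k by rewrite /k; lra.
have ea : effect ((k^-1)%:C *: a).
  split; first exact: adj_scaleR.
  move=> x; rewrite fctE rpZl mulr_ge0 ?invr_ge0 ?(ltW k0) //=.
  rewrite ler_pdivrMl //.
  have := rp_amgm (a x) x (@ltr01 R); rewrite invr1 !mul1r.
  have := ler_norm (rp (a x) x); have := hC x; have := nn_ge0 x; rewrite /k; nra.
have [x [xx bx xE xC]] := effect_sqrt ea.
exists ((Num.sqrt k)%:C *: x); split.
- exact: adj_scaleR.
- exact: bop_scale.
- apply/funext => y; rewrite /= !fctE bopZ // scalerA -rmorphM /=.
  rewrite -expr2 sqr_sqrtr; last exact: ltW.
  have /funeqP/(_ y) /= -> := xE; rewrite !fctE scalerA -rmorphM /= mulfV ?gt_eqF //.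
  by rewrite scale1r.
- move=> t bt ta; apply/funext => y; rewrite /= !fctE bopZ //; congr (_ *: _).
  have /funeqP/(_ y) : t \o x = x \o t; last by [].
  apply: xC => //; apply/funext => z; rewrite /= !fctE bopZ //; congr (_ *: _).
  by have /funeqP/(_ z) := ta.
Qed.

End SquareRoot.

(** * Von Neumann algebras and normality of isomorphisms *)

Section VonNeumann.
Variables (R : realType).
Implicit Types H K : hilbertType R.

Definition sa_closed H (S : set (H -> H)) :=
  forall a, S a -> exists2 b, S b & is_adjoint a b.

Lemma commutant_anti H (S S' : set (H -> H)) :
  S `<=` S' -> commutant S' `<=` commutant S.
Proof. by move=> SS' a [ba h]; split=> // b /SS'; exact: h. Qed.

Lemma sub_bicommutant H (S : set (H -> H)) : S `<=` @bounded_op R H ->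
  S `<=` commutant (commutant S).
Proof. by move=> Sb a Sa; split; [exact: Sb|move=> b [_ h]; rewrite h]. Qed.

Lemma commutant_bounded H (S : set (H -> H)) : commutant S `<=` @bounded_op R H.
Proof. by move=> a []. Qed.

Lemma commutant_sa_closed H (S : set (H -> H)) : sa_closed S ->
  sa_closed (commutant S).
Proof.
move=> Ss a [/bop_bounded_op ba h]; have [a' ba' aa'] := bop_adj ba.
exists a' => //; split; first exact/bop_bounded_op.
move=> b Sb; have [b' Sb' bb'] := Ss _ Sb.
apply: (@adj_unique _ _ _ (b' \o a)).
  exact: (adj_comp aa' (adj_sym bb')).
by rewrite -h //; apply: (adj_comp (adj_sym bb') aa').
Qed.

Lemma vn_commutant H (S : set (H -> H)) : S `<=` @bounded_op R H ->
  sa_closed S -> is_vonNeumann (commutant S).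
Proof.
move=> Sb Ss; split.
- exact: commutant_bounded.
- move=> a b [/bop_bounded_op ba ha] [/bop_bounded_op bb hb]; split.
    by apply/bop_bounded_op; exact: bop_add.
  move=> c Sc; apply/funext => x; rewrite /= !fctE bopD; last exact/bop_bounded_op/Sb.
  by have /funeqP/(_ x) /= -> := ha _ Sc; have /funeqP/(_ x) /= -> := hb _ Sc.
- move=> k a [/bop_bounded_op ba ha]; split.
    by apply/bop_bounded_op; exact: bop_scale.
  move=> c Sc; apply/funext => x; rewrite /= !fctE bopZ; last exact/bop_bounded_op/Sb.
  by have /funeqP/(_ x) /= -> := ha _ Sc.
- move=> a b [/bop_bounded_op ba ha] [/bop_bounded_op bb hb]; split.
    by apply/bop_bounded_op; exact: bop_comp.
  by move=> c Sc; rewrite -compA hb // compA ha.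
- exact: commutant_sa_closed.
- rewrite eqEsubset; split.
    by apply: commutant_anti; exact: sub_bicommutant.
  by apply: sub_bicommutant; exact: commutant_bounded.
Qed.

Lemma vn_sa_closed H (M : set (H -> H)) : is_vonNeumann M -> sa_closed M.
Proof. by move=> vM a /(vn_adjoint vM). Qed.

Lemma vn_bop H (M : set (H -> H)) a : is_vonNeumann M -> M a -> bop a.
Proof. by move=> vM /(vn_bounded vM)/bop_bounded_op. Qed.

(** The bicommutant clause read as a membership test; it stands in for closure in an operator
    topology. *)
Lemma vn_mem H (M : set (H -> H)) a : is_vonNeumann M -> bop a ->
  (forall t, commutant M t -> a \o t = t \o a) -> M a.
Proof.
move=> vM ba h; rewrite -(vn_bicommutant vM).
by split; [exact/bop_bounded_op|].
Qed.

Lemma vn_commute H (M : set (H -> H)) a t : M a -> commutant M t ->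
  t \o a = a \o t.
Proof. by move=> Ma [_ ->]. Qed.

Lemma vn_id H (M : set (H -> H)) : is_vonNeumann M -> M id.
Proof. by move=> vM; apply: (vn_mem vM) => //; exact: bop_id. Qed.

Lemma vn0 H (M : set (H -> H)) : is_vonNeumann M -> M (0 : H -> H).
Proof. by move=> vM; have := vn_scale vM 0 (vn_id vM); rewrite scale0r. Qed.

Lemma vn_sub H (M : set (H -> H)) a b : is_vonNeumann M -> M a -> M b -> M (a - b).
Proof.
by move=> vM Ma Mb; apply: vn_add => //; rewrite -scaleN1r; exact: vn_scale.
Qed.

Lemma vn_adj_mem H (M : set (H -> H)) a b : is_vonNeumann M -> M a -> adj a b -> M b.
Proof.
by move=> vM /(vn_adjoint vM) [c Mc ac] ab; rewrite (adj_unique ab ac).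
Qed.

Lemma vn_all H : is_vonNeumann (@bounded_op R H).
Proof.
have -> : @bounded_op R H = commutant set0.
  by rewrite eqEsubset; split=> [a ba|a []]; [split|].
by apply: vn_commutant.
Qed.

Lemma vn_generatedP H (S : set (H -> H)) : S `<=` @bounded_op R H ->
  is_vonNeumann (vn_generated S).
Proof.
move=> Sb; split.
- by move=> a /(_ _ (@vn_all H) Sb).
- by move=> a b ha hb M vM SM; apply: vn_add => //; [exact: ha|exact: hb].
- by move=> c a ha M vM SM; apply: vn_scale => //; exact: ha.
- by move=> a b ha hb M vM SM; apply: vn_comp => //; [exact: ha|exact: hb].
- move=> a ha; have [b bb ab] := vn_adjoint (@vn_all H) (ha _ (@vn_all H) Sb).
  exists b => // M vM SM; exact: (vn_adj_mem vM (ha _ vM SM)).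
- rewrite eqEsubset; split; last first.
    by apply: sub_bicommutant => a /(_ _ (@vn_all H) Sb).
  move=> a ha M vM SM; rewrite -(vn_bicommutant vM).
  by apply: commutant_anti ha; apply: commutant_anti => b; apply.
Qed.

Lemma sub_vn_generated H (S : set (H -> H)) : S `<=` vn_generated S.
Proof. by move=> a Sa M _; apply. Qed.

Lemma vn_generated_min H (S M : set (H -> H)) : is_vonNeumann M -> S `<=` M ->
  vn_generated S `<=` M.
Proof. by move=> vM SM a; apply. Qed.

Lemma posop_sqrt_mem H (M : set (H -> H)) a : is_vonNeumann M -> M a ->
  posop a -> exists x, [/\ M x, adj x x & x \o x = a].
Proof.
move=> vM Ma pa; have [x [xx bx xE hx]] := posop_sqrt pa (vn_bop vM Ma).
exists x; split=> //; apply: (vn_mem vM bx) => t Mt.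
rewrite hx //; first by case: Mt => /bop_bounded_op.
exact: vn_commute Ma Mt.
Qed.

Lemma vigier_mem H (M C : set (H -> H)) : is_vonNeumann M ->
  C !=set0 -> C `<=` M -> (forall c, C c -> effect c) ->
  (forall c c', C c -> C c' -> qle c c' \/ qle c' c) ->
  exists a, [/\ M a, effect a, forall c, C c -> qle c a &
    forall x k, (forall c, C c -> rp (c x) x <= k) -> rp (a x) x <= k].
Proof.
move=> vM C0 CM Ce Ct; have [a [ea h1 h2 h3 _]] := vigier C0 Ce Ct.
exists a; split=> //; apply: (vn_mem vM); first exact: effect_bop.
move=> t Mt; rewrite h3 //; first by case: Mt => /bop_bounded_op.
by move=> c /CM Mc; exact: vn_commute Mc Mt.
Qed.

Lemma effect_antisym H (a b : H -> H) : effect a -> effect b ->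
  qle a b -> qle b a -> a = b.
Proof.
move=> ea eb ab ba; apply/funext => x; apply/eqP; rewrite eq_sym -subr_eq0.
apply/eqP/nn_eq0/eqP; rewrite eq_le nn_ge0 andbT.
apply: (le_trans (effect_nn x (effect_sub ea eb ab))).
by rewrite fctE rpDl rpNl subr_le0.
Qed.

Lemma effect_adj H (a : H -> H) : effect a -> adj a a.
Proof. by case. Qed.

Lemma fct0E H (x : H) : (0 : H -> H) x = 0. Proof. by []. Qed.

Lemma effect0 H : effect (0 : H -> H).
Proof.
split=> [x y|x]; first by rewrite !fct0E inner0l inner0r.
by rewrite fct0E rp0l lexx nn_ge0.
Qed.

Lemma effect_id H : effect (@id H).
Proof. by split=> // x; rewrite -/(nn x) nn_ge0 lexx. Qed.

(** Zorn's lemma, a nonempty chain being bounded by its supremum from [vigier_mem] and the empty one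
    by 0. The property [P] only has to pass to suprema of chains. *)
Lemma effect_max H (M P : set (H -> H)) : is_vonNeumann M -> P 0 ->
  (forall C a, C `<=` M -> (forall c, C c -> effect c) ->
     (forall c c', C c -> C c' -> qle c c' \/ qle c' c) ->
     C `<=` P -> C !=set0 -> M a -> effect a -> (forall c, C c -> qle c a) ->
     (forall x k, (forall c, C c -> rp (c x) x <= k) -> rp (a x) x <= k) -> P a) ->
  exists a, [/\ M a, effect a, P a &
    forall b, M b -> effect b -> P b -> qle a b -> b = a].
Proof.
move=> vM P0 PC.
pose T := {a : H -> H | [/\ M a, effect a & P a]}.
pose r (s t : T) : bool := `[< qle (sval s) (sval t) >].
have [||||t ht] := @Zorn T r.
- by move=> t; apply/asboolP; exact: qle_refl.
- by move=> a b c /asboolP h1 /asboolP h2; apply/asboolP; exact: qle_trans h2.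
- move=> [a [Ma ea Pa]] [b [Mb eb Pb]] /asboolP /= h1 /asboolP /= h2.
  by apply: eq_exist; exact: effect_antisym.
- move=> A Atot; have [A0|A0] := pselect (A !=set0); last first.
    have z : [/\ M (0 : H -> H), effect (0 : H -> H) & P 0].
      by split=> //; [exact: vn0|exact: effect0].
    by exists (exist _ 0 z) => s As; case: A0; exists s.
  pose C := [set sval s | s in A].
  have C0 : C !=set0 by case: A0 => s As; exists (sval s), s.
  have CM : C `<=` M by move=> _ [[c [Mc ec Pc]] _ <-].
  have Ce c : C c -> effect c by move=> [[c' [Mc ec Pc]] _ <-].
  have CP : C `<=` P by move=> _ [[c [Mc ec Pc]] _ <-].
  have Ct c c' : C c -> C c' -> qle c c' \/ qle c' c.
    move=> [s As <-] [s' As' <-].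
    by case: (Atot s s' As As') => /asboolP h; [left|right].
  have [a [Ma ea h1 h2]] := vigier_mem vM C0 CM Ce Ct.
  have Pa : P a by apply: (PC C).
  exists (exist _ a (And3 Ma ea Pa)) => s As; apply/asboolP => /=.
  by apply: h1; exists s.
case: t ht => a [Ma ea Pa] ht; exists a; split=> // b Mb eb Pb ab.
have := ht (exist _ b (And3 Mb eb Pb)).
by move=> /(_ (asboolT ab)) /(congr1 sval).
Qed.

(** * Isomorphisms preserve order and suprema of chains *)

Definition vn_iso H K (M : set (H -> H)) (N : set (K -> K))
    (theta : (H -> H) -> (K -> K)) :=
    [/\ set_bij M N theta,
        forall a b, M a -> M b -> theta (a + b) = theta a + theta b,
        forall (c : R[i]) a, M a -> theta (c *: a) = c *: theta a,
        forall a b, M a -> M b -> theta (a \o b) = theta a \o theta b &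
        forall a b, M a -> M b -> is_adjoint a b ->
          is_adjoint (theta a) (theta b)].

Lemma vn_iso_mem H K (M : set (H -> H)) (N : set (K -> K)) theta a :
  vn_iso M N theta -> M a -> N (theta a).
Proof. by move=> [[h _ _] _ _ _ _]; exact: h. Qed.

Lemma vn_iso_surj H K (M : set (H -> H)) (N : set (K -> K)) theta b :
  vn_iso M N theta -> N b -> exists2 a, M a & theta a = b.
Proof. by move=> [[_ _ h] _ _ _ _] /h [a Ma <-]; exists a. Qed.

Lemma vn_iso_inj H K (M : set (H -> H)) (N : set (K -> K)) theta a b :
  vn_iso M N theta -> M a -> M b -> theta a = theta b -> a = b.
Proof. by move=> [[_ h _] _ _ _ _] Ma Mb; apply: h; exact/mem_set. Qed.

Lemma vn_iso_sub H K (M : set (H -> H)) (N : set (K -> K)) theta a b :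
  is_vonNeumann M -> vn_iso M N theta -> M a -> M b ->
  theta (a - b) = theta a - theta b.
Proof.
move=> vM [_ hD hZ _ _] Ma Mb; rewrite -scaleN1r hD //; last exact: vn_scale.
by rewrite hZ // scaleN1r.
Qed.

Lemma vn_iso_id H K (M : set (H -> H)) (N : set (K -> K)) theta :
  is_vonNeumann M -> is_vonNeumann N -> vn_iso M N theta -> theta id = id.
Proof.
move=> vM vN iso; have [a Ma aE] := vn_iso_surj iso (vn_id vN).
have [_ _ _ hM _] := iso.
by have := hM _ _ (vn_id vM) Ma; rewrite aE.
Qed.

Lemma vn_iso_sym H K (M : set (H -> H)) (N : set (K -> K)) theta :
  is_vonNeumann M -> is_vonNeumann N ->
  vn_iso M N theta -> exists theta', [/\ vn_iso N M theta',
    forall a, M a -> theta' (theta a) = a &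
    forall b, N b -> theta (theta' b) = b].
Proof.
move=> vM vN iso.
have /choice [th hth] : forall b, exists a, N b -> M a /\ theta a = b.
  move=> b; have [Nb|nN] := pselect (N b); last by exists id.
  by have [a Ma aE] := vn_iso_surj iso Nb; exists a.
have thM b : N b -> M (th b) by move=> /hth [].
have thK b : N b -> theta (th b) = b by move=> /hth [].
have Kth a : M a -> th (theta a) = a.
  by move=> Ma; apply: (vn_iso_inj iso) => //; rewrite ?thK //; first apply: thM;
    exact: vn_iso_mem iso Ma.
have [_ hD hZ hM hA] := iso.
have inj a b : M a -> M b -> theta a = theta b -> a = b by exact: vn_iso_inj iso.
exists th; split=> //; split.
- split=> // [a b /set_mem Na /set_mem Nb e|a Ma].
    by rewrite -(thK _ Na) -(thK _ Nb) e.
  by exists (theta a); [exact: vn_iso_mem iso Ma|exact: Kth].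
- move=> a b Na Nb; apply: inj; [apply: thM; exact: vn_add| |].
    by apply: vn_add => //; exact: thM.
  by rewrite hD ?thK //; try exact: thM; exact: vn_add.
- move=> c a Na; apply: inj; [apply: thM; exact: vn_scale| |].
    by apply: vn_scale => //; exact: thM.
  by rewrite hZ ?thK //; try exact: thM; exact: vn_scale.
- move=> a b Na Nb; apply: inj; [apply: thM; exact: vn_comp| |].
    by apply: vn_comp => //; exact: thM.
  by rewrite hM ?thK //; try exact: thM; exact: vn_comp.
- move=> a b Na Nb ab; have [c Mc ac] := vn_adjoint vM (thM _ Na).
  have := hA _ _ (thM _ Na) Mc ac; rewrite thK // => /(adj_unique ab) bE.
  by rewrite bE Kth.
Qed.

(** A positive element of [M] is a square x x with x self-adjoint in [M], a property that [theta]
    transports algebraically. *)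
Lemma vn_iso_posop H K (M : set (H -> H)) (N : set (K -> K)) theta a :
  is_vonNeumann M -> vn_iso M N theta -> M a -> posop a -> posop (theta a).
Proof.
move=> vM iso Ma pa; have [x [Mx xx <-]] := posop_sqrt_mem vM Ma pa.
have [_ _ _ hM hA] := iso.
have txx : adj (theta x) (theta x) by exact: hA.
rewrite hM //; split; first exact: (adj_comp txx txx).
by move=> y; rewrite /= (adj_rp _ _ txx) nn_ge0.
Qed.

Lemma posopE H (a b : H -> H) : adj a a -> adj b b -> (posop (b - a) <-> qle a b).
Proof.
move=> aa bb; split=> [[_ h] x|h].
  by have := h x; rewrite !fctE rpDl rpNl subr_ge0.
split; first exact: adj_sub.
by move=> x; rewrite !fctE rpDl rpNl subr_ge0.
Qed.

Lemma vn_iso_qle H K (M : set (H -> H)) (N : set (K -> K)) theta a b :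
  is_vonNeumann M -> vn_iso M N theta -> M a -> M b -> adj a a -> adj b b ->
  qle a b -> qle (theta a) (theta b).
Proof.
move=> vM iso Ma Mb aa bb /(posopE aa bb) h.
have [_ _ _ _ hA] := iso.
apply/posopE; [exact: hA|exact: hA|rewrite -(vn_iso_sub vM iso) //].
by apply: (vn_iso_posop vM iso) h; exact: vn_sub.
Qed.

Lemma effectE H (a : H -> H) : effect a <-> [/\ adj a a, qle 0 a & qle a id].
Proof.
split=> [[aa h]|[aa h0 h1]]; split=> //.
- by move=> x; rewrite fct0E rp0l; case/andP: (h x).
- by move=> x; case/andP: (h x).
- by move=> x; have := h0 x; have := h1 x; rewrite fct0E rp0l => -> ->.
Qed.

Lemma vn_iso0 H K (M : set (H -> H)) (N : set (K -> K)) theta :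
  is_vonNeumann M -> vn_iso M N theta -> theta 0 = 0.
Proof.
by move=> vM [_ _ hZ _ _]; rewrite -(scale0r (0 : H -> H)) hZ ?scale0r //; exact: vn0.
Qed.

Lemma vn_iso_effect H K (M : set (H -> H)) (N : set (K -> K)) theta a :
  is_vonNeumann M -> is_vonNeumann N -> vn_iso M N theta -> M a -> effect a ->
  effect (theta a).
Proof.
move=> vM vN iso Ma /effectE [aa h0 h1]; have [_ _ _ _ hA] := iso.
apply/effectE; split; first exact: hA.
- rewrite -(vn_iso0 vM iso); apply: (vn_iso_qle vM iso) => //; first exact: vn0.
  by case: (@effect0 H).
- rewrite -(vn_iso_id vM vN iso); apply: (vn_iso_qle vM iso) => //; exact: vn_id.
Qed.

(** The supremum d of theta(C), taken in [N], is pulled back by the inverse isomorphism to an upper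
    bound of [C]. So a lies below it, and theta a below d. *)
Lemma vn_iso_normal H K (M : set (H -> H)) (N : set (K -> K)) theta C a eta k :
  is_vonNeumann M -> is_vonNeumann N -> vn_iso M N theta ->
  C !=set0 -> C `<=` M -> (forall c, C c -> effect c) ->
  (forall c c', C c -> C c' -> qle c c' \/ qle c' c) ->
  M a -> effect a ->
  (forall x k, (forall c, C c -> rp (c x) x <= k) -> rp (a x) x <= k) ->
  (forall c, C c -> rp (theta c eta) eta <= k) -> rp (theta a eta) eta <= k.
Proof.
move=> vM vN iso C0 CM Ce Ct Ma ea ha hk.
have [th [iso' thK Kth]] := vn_iso_sym vM vN iso.
pose D := [set theta c | c in C].
have [|||_ _ [c Cc <-] [c' Cc' <-]|d [Nd ed hd1 hd2]] := @vigier_mem _ N D vN.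
- by case: C0 => c Cc; exists (theta c), c.
- by move=> _ [c Cc <-]; exact: vn_iso_mem iso (CM _ Cc).
- by move=> _ [c Cc <-]; apply: (vn_iso_effect vM vN iso); [exact: CM|exact: Ce].
- by case: (Ct _ _ Cc Cc') => h; [left|right];
    apply: (vn_iso_qle vM iso) => //; try exact: CM; apply: effect_adj; exact: Ce.
have Mb := vn_iso_mem iso' Nd; have eb := vn_iso_effect vN vM iso' Nd ed.
have ab : qle a (th d).
  move=> x; apply: ha => c Cc; rewrite -(thK c (CM _ Cc)).
  apply: (vn_iso_qle vN iso') => //.
  - exact: vn_iso_mem iso (CM _ Cc).
  - by apply/effect_adj/(vn_iso_effect vM vN iso); [exact: CM|exact: Ce].
  - exact: effect_adj.
  - by apply: hd1; exists c.
have := vn_iso_qle vM iso Ma Mb (effect_adj ea) (effect_adj eb) ab eta.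
rewrite Kth // => h; apply: (le_trans h).
by apply: hd2 => _ [c Cc <-]; exact: hk.
Qed.

End VonNeumann.

(** * Intertwiners *)

Section Intertwiner.
Variables (R : realType) (H K : hilbertType R).
Variables (M : set (H -> H)) (N : set (K -> K)) (theta : (H -> H) -> (K -> K)).
Hypotheses (vM : is_vonNeumann M) (vN : is_vonNeumann N) (iso : vn_iso M N theta).

Lemma vstate_sub a b (eta : K) : M a -> M b ->
  rp (theta (a - b) eta) eta = rp (theta a eta) eta - rp (theta b eta) eta.
Proof.
by move=> Ma Mb; rewrite (vn_iso_sub vM iso Ma Mb) fctE rpDl rpNl.
Qed.

Lemma vstate_add a b (eta : K) : M a -> M b ->
  rp (theta (a + b) eta) eta = rp (theta a eta) eta + rp (theta b eta) eta.
Proof.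
by move=> Ma Mb; have [_ hD _ _ _] := iso; rewrite hD // fctE rpDl.
Qed.

Lemma vstate_le a b (eta : K) : M a -> M b -> effect a -> effect b -> qle a b ->
  rp (theta a eta) eta <= rp (theta b eta) eta.
Proof.
by move=> Ma Mb ea eb ab; apply: (vn_iso_qle vM iso) => //; exact: effect_adj.
Qed.

Lemma effect_add_le (a b s : H -> H) : effect a -> effect b -> effect s ->
  qle b (s - a) -> effect (a + b) /\ qle (a + b) s.
Proof.
move=> [aa ha] [bb hb] [ss hs] h.
have le : qle (a + b) s.
  by move=> x; have := h x; rewrite !fctE !rpE; lra.
split=> //; split; first exact: adj_add.
move=> x; have := le x; rewrite !fctE !rpE.
by have := ha x; have := hb x; have := hs x => /andP[? ?] /andP[? ?] /andP[? ?] ?;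
  apply/andP; split; lra.
Qed.

(* The complement s of a maximal effect of state 0 makes the pulled back vector
   state faithful below s, which is what ensures that the state of h is positive
   for the complement h in s of a maximal effect where the state dominates the
   vector functional of xi. *)
Lemma dominated_effect (eta : K) : eta != 0 -> exists h xi,
  [/\ M h, effect h, 0 < rp (theta h eta) eta &
    forall b, M b -> effect b -> qle b h ->
      rp (theta b eta) eta <= rp (b xi) xi].
Proof.
move=> eta0.
have M0 := vn0 vM; have e0 := @effect0 _ H; have Mid := vn_id vM.
have th0 : rp (theta 0 eta) eta = 0 by rewrite (vn_iso0 vM iso) fct0E rp0l.
have [||a0 [Ma0 ea0 Pa0 max0]] := @effect_max _ H M
    [set a | rp (theta a eta) eta <= 0] vM.
- by rewrite /= th0.
- move=> C a CM Ce Ct CP C0 Ma ea ub lub.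
  exact: (vn_iso_normal vM vN iso C0 CM Ce Ct Ma ea lub).
pose s : H -> H := id - a0.
have Ms : M s by exact: vn_sub.
have es : effect s.
  by apply: effect_sub => //; [exact: effect_id|case/effectE: ea0].
have faith b : M b -> effect b -> qle b s -> rp (theta b eta) eta <= 0 -> b = 0.
  move=> Mb eb bs pb.
  have [e1 e2] := effect_add_le ea0 eb (@effect_id _ H) bs.
  have : a0 + b = a0.
    apply: max0 => //; first exact: vn_add.
      by rewrite /= vstate_add //; move: Pa0 => /=; lra.
    by move=> x; rewrite fctE rpDl lerDl; case: eb => _ /(_ x) /andP[].
  by move=> /(congr1 (fun f => f - a0)); rewrite addrAC subrr add0r.
have phis : 0 < rp (theta s eta) eta.
  rewrite vstate_sub // (vn_iso_id vM vN iso).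
  have : 0 < nn eta.
    rewrite lt_neqAle nn_ge0 andbT eq_sym; apply/eqP => /nn_eq0 h.
    by rewrite h eqxx in eta0.
  by move: Pa0; rewrite /nn /=; lra.
have [xi0 hxi0] : exists xi0, 0 < rp (s xi0) xi0.
  apply: contrapT => hn; have s0 : s = 0.
    apply/funext => x; apply: nn_eq0; apply/eqP; rewrite eq_le nn_ge0 andbT.
    apply: (le_trans (effect_nn x es)); rewrite leNgt; apply/negP => h.
    by apply: hn; exists x.
  by move: phis; rewrite s0 th0 ltxx.
set r := rp (s xi0) xi0 in hxi0; set f := rp (theta s eta) eta in phis.
(* With this choice t^2 r >= t r = f + r > f: at [s] the vector functional of [xi] exceeds the
   state, which excludes a1 = s below. *)
pose t := f / r + 1.
have t1 : 1 <= t by rewrite /t lerDr divr_ge0 // ltW.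
have tr : t * r = f + r by rewrite /t mulrDl mul1r divfK // gt_eqF.
pose xi := t%:C *: xi0.
have sxi : f < rp (s xi) xi.
  rewrite /xi bopZ; last exact: effect_bop.
  by rewrite rpZl rpZr -/r tr; nra.
have [||a1 [Ma1 ea1 [a1s Pa1] max1]] := @effect_max _ H M
    [set a | qle a s /\ rp (a xi) xi <= rp (theta a eta) eta] vM.
- split; last by rewrite th0 fct0E rp0l.
  by case/effectE: es.
- move=> C a CM Ce Ct CP C0 Ma ea ub lub; split.
    by move=> x; apply: lub => c /CP [+ _]; apply.
  apply: lub => c Cc; have [_ h] := CP _ Cc; apply: (le_trans h).
  by apply: vstate_le => //; [exact: CM|exact: Ce|exact: ub].
pose h : H -> H := s - a1.
have Mh : M h by exact: vn_sub.
have eh : effect h by exact: effect_sub.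
have hs : qle h s.
  move=> x; rewrite /h fctE rpDl rpNl gerDl oppr_le0.
  by case: ea1 => _ /(_ x) /andP[].
exists h, xi; split=> //.
- rewrite ltNge; apply/negP => /(faith _ Mh eh hs) h0.
  have sa : s = a1 by apply/eqP; rewrite -subr_eq0 -/h h0.
  by move: Pa1; rewrite -sa -/f leNgt sxi.
- move=> b Mb eb bh; rewrite leNgt; apply/negP => lt.
  have [e1 e2] := effect_add_le ea1 eb es bh.
  have : a1 + b = a1.
    apply: max1 => //; first exact: vn_add.
      by split=> //; rewrite vstate_add // fctE rpDl; lra.
    by move=> x; rewrite fctE rpDl lerDl; case: eb => _ /(_ x) /andP[].
  move=> /(congr1 (fun f => f - a1)); rewrite addrAC subrr add0r => b0.
  by move: lt; rewrite b0 th0 fct0E rp0l ltxx.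
Qed.

(** Domination is known only for effects below [h]. Divided by k = C + 1, the operator h x^* x h is
    one, and the factor cancels from both sides. *)
Lemma dominated_nn h (xi : H) (eta : K) x : M h -> effect h ->
  (forall b, M b -> effect b -> qle b h ->
      rp (theta b eta) eta <= rp (b xi) xi) ->
  M x -> nn (theta x (theta h eta)) <= nn (x (h xi)).
Proof.
move=> Mh eh hd Mx.
have [_ hD hZ hM hA] := iso.
have bx := vn_bop vM Mx; have [_ [C C0 hC]] := bx.
have [x' Mx' xx'] := vn_adjoint vM Mx.
have hh := effect_adj eh.
pose k := C + 1; have k0 : 0 < k by rewrite /k; lra.
pose g : H -> H := (h \o x') \o (x \o h).
have Mg : M g by do 2?apply: vn_comp => //; exact: vn_comp.
pose b : H -> H := (k^-1)%:C *: g.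
have Mb : M b by exact: vn_scale.
have gg : adj g g.
  exact: (adj_comp (adj_comp hh xx') (adj_comp (adj_sym xx') hh)).
have gE y z : rp (g y) z = rp (x (h y)) (x (h z)).
  by rewrite /g /= (adj_rp _ _ hh) (adj_rp _ _ (adj_sym xx')).
(* h x^* x h <= k h^2 <= k h. *)
have bh : qle b h.
  move=> y; rewrite /b fctE rpZl gE -/(nn _) ler_pdivrMl //.
  have := hC (h y); have := effect_nn y eh; have := nn_ge0 (h y); rewrite /k.
  nra.
have eb : effect b.
  split; first exact: adj_scaleR.
  move=> y; apply/andP; split.
    by rewrite /b fctE rpZl gE mulr_ge0 ?nn_ge0 // invr_ge0 ltW.
  by apply: (le_trans (bh y)); case: eh => _ /(_ y) /andP[].
have := hd b Mb eb bh.
have -> : theta b = (k^-1)%:C *: theta g by rewrite hZ.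
rewrite /b !fctE !rpZl ler_pM2l ?invr_gt0 // gE -/(nn (x (h xi))).
have -> : theta g = (theta h \o theta x') \o (theta x \o theta h).
  by rewrite (hM (h \o x') (x \o h)) ?(hM h x') ?(hM x h) //; exact: vn_comp.
by rewrite /= (adj_rp _ _ (hA _ _ Mh Mh hh)) (adj_rp _ _ (hA _ _ Mx' Mx (adj_sym xx'))).
Qed.

(** [w] is the adjoint of the contraction x h xi |-> theta(x) theta(h) eta. Its range lies in the
    closure of the M-invariant space M h xi, whence the intertwining relation, and inner (h xi) (w
    eta) = inner (theta h eta) eta, of positive real part, shows that w eta is nonzero. *)
Lemma intertwiner (eta : K) : eta != 0 -> exists w : K -> H,
  [/\ bop w, forall y, M y -> w \o theta y = y \o w & w eta != 0].
Proof.
move=> eta0; have [h [xi [Mh eh ph hd]]] := dominated_effect eta0.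
have [_ hD hZ hM hA] := iso.
pose G : set (H * K) := [set (x (h xi), theta x (theta h eta)) | x in M].
have [|c _ _ [x Mx <-] [y My <-]|_ [x Mx <-]|w [bw w1 w2]] :=
    @riesz_graph _ _ _ G 1 ler01.
- exists 0; first exact: vn0.
  by rewrite (vn_iso0 vM iso) !fct0E.
- exists (c *: x + y); first by apply: vn_add => //; exact: vn_scale.
  by rewrite hD ?hZ //; exact: vn_scale.
- by rewrite /= mul1r; exact: dominated_nn.
have w1' x k : M x -> inner (theta x (theta h eta)) k = inner (x (h xi)) (w k).
  by move=> Mx; rewrite -(w1 (x (h xi), theta x (theta h eta))) //; exists x.
have w2' z : (forall x, M x -> inner (x (h xi)) z = 0) -> forall k, inner (w k) z = 0.
  by move=> hz; apply: w2 => _ [x Mx <-]; exact: hz.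
exists w; split=> // [y My|].
  apply/funext => k /=; apply/eqP; rewrite -subr_eq0 -(dnorm_eq0 inner); apply/eqP.
  set z := _ - _.
  have [y' My' yy'] := vn_adjoint vM My.
  have z0 x : M x -> inner (x (h xi)) z = 0.
    move=> Mx; rewrite innerBr -w1' // -(hA _ _ My' My (adj_sym yy')).
    rewrite -[inner (x (h xi)) _](adj_sym yy').
    rewrite -[y' (x (h xi))]/((y' \o x) (h xi)) -w1'; last exact: vn_comp.
    by rewrite hM // subrr.
  rewrite {1}/z innerBl w2' // yy' w2' ?subrr // => x Mx.
  rewrite -yy' -[y (x (h xi))]/((y \o x) (h xi)) z0 //; exact: vn_comp.
apply/eqP => w0; have := w1' id eta (vn_id vM).
rewrite w0 inner0r (vn_iso_id vM vN iso) /= => h0.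
by move: ph; rewrite /rp h0 ltxx.
Qed.

End Intertwiner.

Lemma vn_iso_generated (R : realType) (H K : hilbertType R)
    (M : set (H -> H)) (N : set (K -> K)) theta (S : set (H -> H)) :
  is_vonNeumann M -> is_vonNeumann N -> vn_iso M N theta ->
  S `<=` M -> vn_generated S = M -> vn_generated [set theta a | a in S] = N.
Proof.
move=> vM vN iso SM SE; rewrite eqEsubset; split.
  by apply: vn_generated_min => // _ [a Sa <-]; exact: vn_iso_mem iso (SM _ Sa).
move=> b Nb N1 vN1 SN1; apply: (vn_mem vN1 (vn_bop vN Nb)) => t tN1.
have [_ _ _ _ hA] := iso.
have bt : bop t by apply/bop_bounded_op; case: tN1.
(* [D] contains [S], so its bicommutant contains [M], but [theta] is not known to send that
   bicommutant into [N1]. *)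
pose D := [set a | M a /\ N1 (theta a)].
have vD : is_vonNeumann (commutant (commutant D)).
  apply: vn_commutant; first exact: commutant_bounded.
  apply: commutant_sa_closed => a [Ma Na].
  have [a' Ma' aa'] := vn_adjoint vM Ma; exists a' => //; split=> //.
  exact: (vn_adj_mem vN1 Na (hA _ _ Ma Ma' aa')).
have DM : D `<=` @bounded_op R H by move=> a [Ma _]; exact: (vn_bounded vM).
have MD : M `<=` commutant (commutant D).
  rewrite -SE; apply: vn_generated_min => // a Sa.
  by apply: sub_bicommutant => //; split; [exact: SM|apply: SN1; exists a].
have DcM u : bop u -> (forall a, D a -> u \o a = a \o u) ->
    forall a, M a -> u \o a = a \o u.
  move=> bu hu a /MD [_ h]; apply/esym/h; split=> //; exact/bop_bounded_op.
have [a Ma ab] := vn_iso_surj iso Nb.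
pose z : K -> K := (b \o t) - (t \o b).
have bb := vn_bop vN Nb.
have bz : bop z by apply: bop_sub; exact: bop_comp.
have [z' bz' zz'] := bop_adj bz.
have adjw w : bop w -> (forall y, M y -> w \o theta y = y \o w) ->
    exists v, [/\ bop v, adj w v & forall y, M y -> theta y \o v = v \o y].
  move=> bw hw; have [v bv wv] := bop_adj bw; exists v; split=> // y My.
  have [y' My' yy'] := vn_adjoint vM My.
  apply: (@adj_unique _ _ _ (w \o theta y')).
    exact: (adj_comp (adj_sym (hA _ _ My My' yy')) wv).
  by rewrite hw //; exact: (adj_comp wv (adj_sym yy')).
have wzv w v : bop w -> (forall y, M y -> w \o theta y = y \o w) ->
    bop v -> (forall y, M y -> theta y \o v = v \o y) ->
    forall x, w (z (v x)) = 0.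
  move=> bw hw bv hv x.
  have wE y k : M y -> w (theta y k) = y (w k) by move=> /hw /funeqP/(_ k).
  have vE y k : M y -> theta y (v k) = v (y k) by move=> /hv /funeqP/(_ k).
  (* This operator on H, with [v] the adjoint of an intertwiner, commutes with [D], hence with [M].
     Commutation with [a], where theta a = b, says w z v = 0. *)
  have bu : bop (w \o (t \o v)) := bop_comp (bop_comp bv bt) bw.
  have uD d : D d -> (w \o (t \o v)) \o d = d \o (w \o (t \o v)).
    move=> [Md Nd]; apply/funext => y /=; rewrite -vE // -wE //.
    by have [_ /(_ _ Nd) /funeqP/(_ (v y)) /= ->] := tN1.
  have /funeqP/(_ x) /= h := DcM _ bu uD _ Ma.
  by rewrite /z -ab !fctE /= bopB // wE // vE // h subrr.
have sep k : (forall w, bop w -> (forall y, M y -> w \o theta y = y \o w) ->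
    w k = 0) -> k = 0.
  move=> h; apply/eqP; apply: contrapT => /negP k0.
  by have [w [bw hw /eqP]] := intertwiner vM vN iso k0; apply; exact: h.
(* Separation is used on both sides: it removes [w'] from w' z v = 0, and then, through adjoints,
   [v]. *)
have z'0 k : z' k = 0.
  apply: (sep) => w bw hw; have [v [bv wv hv]] := adjw _ bw hw.
  apply: inner_ext => x; rewrite wv inner0l (adj_sym zz').
  rewrite (_ : z (v x) = 0) ?inner0r //.
  by apply: sep => w' bw' hw'; exact: (wzv _ _ bw' hw' bv hv x).
apply/funext => x; apply/eqP; rewrite -subr_eq0 -[_ - _]/(z x); apply/eqP.
by apply: inner_ext => k; rewrite zz' z'0 inner0r inner0l.
Qed.

(** * Tensor products and slices *)

Section Tensor.
Variables (R : realType).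
Implicit Types H K T : hilbertType R.

(** This form is symmetric in the two factors, so by [is_tensor_swap] each statement about the
    second one also serves the first. Bilinearity follows from the inner product formula. *)
Definition is_tensor H K T (tau : H -> K -> T) :=
  (forall x x' y y', inner (tau x y) (tau x' y') = inner x x' * inner y y') /\
  (forall z, (forall x y, inner (tau x y) z = 0) -> z = 0).

Lemma is_tensor_swap H K T (tau : H -> K -> T) :
  is_tensor tau -> is_tensor (fun y x => tau x y).
Proof.
move=> [h1 h2]; split=> [x x' y y'|z hz]; first by rewrite h1 mulrC.
by apply: h2 => x y; exact: hz.
Qed.

Lemma hilbert_tensorP H K (T : hilbert_tensor H K) :
  @is_tensor H K T (fun x y => tensor T x y).
Proof.
split=> [|z hz]; first exact: inner_tensor.
apply: nn_eq0; apply/eqP; rewrite eq_le nn_ge0 andbT.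
apply/ler_addgt0Pl => e e0; rewrite addr0.
have s0 : 0 < Num.sqrt e by rewrite sqrtr_gt0.
have e1 : (0 : R[i]) < (Num.sqrt e)%:C by rewrite ltcR.
have zc : closure [set z : T | exists n (x : 'I_n -> H) (y : 'I_n -> K),
    z = \sum_i tensor T (x i) (y i)] z by rewrite tensor_dense.
have [_ [[n [x [y ->]]]]] := zc _ (nbhsx_ballx z _ e1).
rewrite -ball_normE /ball_ /= -nn_lt_norm // sqr_sqrtr; last exact: ltW.
set s := \sum_i _ => /ltW le.
have : rp z s = 0.
  by rewrite rpC /rp inner_suml big1 // => i _; exact: hz.
by move: le; rewrite nnB => + h; rewrite h; have := nn_ge0 s; lra.
Qed.

Section TensorTheory.
Variables (H K T : hilbertType R) (tau : H -> K -> T).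
Hypothesis tauP : is_tensor tau.

Let tau_inner x x' y y' : inner (tau x y) (tau x' y') = inner x x' * inner y y'.
Proof. by case: tauP. Qed.

Lemma tensor_ext z z' :
  (forall x y, inner z (tau x y) = inner z' (tau x y)) -> z = z'.
Proof.
move=> h; apply/eqP; rewrite -subr_eq0; apply/eqP; case: tauP => _; apply.
by move=> x y; rewrite innerC innerBl h subrr conjC0.
Qed.

Lemma bop_ext (a b : T -> T) : bop a -> bop b ->
  (forall x y, a (tau x y) = b (tau x y)) -> a = b.
Proof.
move=> ba bb h; have bz := bop_sub ba bb; have [z' _ zz'] := bop_adj bz.
apply/funext => t; apply/eqP; rewrite -subr_eq0; apply/eqP.
apply: inner_ext => u; rewrite -[_ - _]/((a - b) t) zz' inner0l.
rewrite (_ : z' u = 0) ?inner0r //; case: tauP => _; apply => x y.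
by rewrite -zz' !fctE h subrr inner0l.
Qed.

Lemma tensor_bop x : bop (tau x).
Proof.
split=> [c y y'|].
  apply: tensor_ext => x1 y1; rewrite innerDl innerZl !tau_inner innerDl innerZl.
  by ring.
exists (nn x); first exact: nn_ge0.
by move=> y; rewrite -lecR -inner_nn tau_inner !inner_nn -rmorphM.
Qed.

Lemma tensorZl c x y : tau (c *: x) y = c *: tau x y.
Proof. by apply: tensor_ext => x1 y1; rewrite innerZl !tau_inner innerZl mulrA. Qed.

(** [c] is 1 (x) b, or b (x) 1 when the factors are swapped. *)
Definition is_lift (b : K -> K) (c : T -> T) :=
  bop c /\ forall x y, c (tau x y) = tau x (b y).

Lemma is_lift_adj b b' c c' : adj b b' -> is_lift b c -> bop c' -> adj c c' ->
  is_lift b' c'.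
Proof.
move=> bb' [bc hc] bc' cc'; split=> // x y; apply: tensor_ext => x1 y1.
by rewrite (adj_sym cc') hc !tau_inner (adj_sym bb').
Qed.

(** A sum of elementary tensors has many expressions, so 1 (x) b is given by a graph over lists; the
    bound [SC] makes it single valued and bounded at once. *)
Lemma lift_ex b : bop b -> exists c, is_lift b c.
Proof.
move=> bb; have [_ [C C0 hC]] := bb.
have [b' bb1 bb'] := bop_adj bb.
pose d : K -> K := C%:C *: id - (b' \o b).
have pd : posop d.
  split; first exact: adj_sub (adj_scaleR _ (@adj_id _ _)) (adj_comp bb' (adj_sym bb')).
  move=> x; rewrite /d !fctE /= rpDl rpNl rpZl (adj_rp _ _ (adj_sym bb')) -/(nn x) -/(nn _).
  by rewrite subr_ge0.
have bd : bop d.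
  by apply: bop_sub; [apply: bop_scale; exact: bop_id|exact: bop_comp].
have [e [ee be eE _]] := posop_sqrt pd bd.
have key y y' : inner (b y) (b y') + inner (e y) (e y') = C%:C * inner y y'.
  rewrite bb' ee -[e (e y')]/((e \o e) y') eE /d !fctE /= innerBr innerZr.
  by rewrite conj_Creal ?realE ?lecR ?C0 // addrC subrK.
pose S (f : K -> K) (l : seq (H * K)) := \sum_(p <- l) tau p.1 (f p.2).
have SE f l : inner (S f l) (S f l) = \sum_(p <- l) \sum_(q <- l)
    inner p.1 q.1 * inner (f p.2) (f q.2).
  rewrite /S linear_sumlz; apply: eq_bigr => p _.
  by rewrite linear_sumr; apply: eq_bigr => q _; rewrite /= tau_inner.
(* With e^2 = C - b^* b, |sum x (x) b y|^2 + |sum x (x) e y|^2 = C |sum x (x) y|^2. *)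
have SC l : nn (S b l) <= C * nn (S id l).
  have : nn (S b l) + nn (S e l) = C * nn (S id l).
    apply: (@complexI R); rewrite rmorphD rmorphM /= -!inner_nn !SE.
    rewrite -big_split mulr_sumr; apply: eq_bigr => p _.
    rewrite -big_split mulr_sumr; apply: eq_bigr => q _ /=.
    by rewrite -mulrDr key mulrCA.
  by have := nn_ge0 (S e l); lra.
have [|c _ _ [l _ <-] [l' _ <-]|_ [l _ <-]|c [c' [bc _ _ cG _]]] :=
    @graph_op _ _ _ [set (S id l, S b l) | l in [set: seq (H * K)]] C C0.
- by exists [::] => //; rewrite /S !big_nil.
- exists ([seq (c *: p.1, p.2) | p <- l] ++ l') => //.
  rewrite /S !big_cat !big_map /= !scaler_sumr; congr (_ + _, _ + _).
    by apply: eq_bigr => p _; rewrite tensorZl.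
  by apply: eq_bigr => p _; rewrite tensorZl.
- exact: SC.
exists c; split=> // x y.
have := cG (S id [:: (x, y)], S b [:: (x, y)]).
by rewrite /S !big_seq1; apply; exists [:: (x, y)] => //; rewrite !big_seq1.
Qed.

(** * Slice maps and commutation *)

Definition total_set (X : set H) := forall h, (forall x, X x -> inner x h = 0) -> h = 0.

(* The slice (omega (x) id)(t) for omega a = inner (a xi) eta; by Riesz the
   default value of xget is never used. *)
Definition slice (xi eta : H) (t : T -> T) (k : K) : K :=
  xget 0 [set l | forall k', inner l k' = inner (t (tau xi k)) (tau eta k')].

Lemma sliceP xi eta t k k' :
  inner (slice xi eta t k) k' = inner (t (tau xi k)) (tau eta k').
Proof.
have [v bv hv] := bop_adj (tensor_bop eta).
rewrite /slice; case: xgetP => [l _ -> //|/(_ (v (t (tau xi k))))[]] k1.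
by rewrite innerC -hv -innerC.
Qed.

Lemma slice_bop xi eta t : bop t -> bop (slice xi eta t).
Proof.
move=> bt; have [v bv hv] := bop_adj (tensor_bop eta).
have -> : slice xi eta t = v \o (t \o tau xi).
  apply/funext => k; apply: inner_ext => k'.
  by rewrite sliceP /= -(adj_sym hv).
by apply: bop_comp => //; apply: bop_comp => //; exact: tensor_bop.
Qed.

Lemma slice_adj xi eta t t' : adj t t' -> adj (slice xi eta t) (slice eta xi t').
Proof. by move=> tt' k k'; rewrite sliceP tt' [RHS]innerC sliceP -innerC. Qed.

Lemma tensor_ext0 z : (forall x y, inner z (tau x y) = 0) -> z = 0.
Proof. by move=> h; apply: tensor_ext => x y; rewrite inner0l. Qed.
End TensorTheory.

Section SliceCommute.
Variables (H K T : hilbertType R) (tau : H -> K -> T).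
Hypothesis tauP : is_tensor tau.
Let tauP' := is_tensor_swap tauP.

(** Totality is used once in each argument, vectors of T being pulled back to H by the adjoints of x
    |-> tau x k. *)
Lemma total_eq0 (X : set H) (y : T -> T) : total_set X -> bop y ->
  (forall x x' k k', X x -> X x' -> inner (y (tau x k)) (tau x' k') = 0) ->
  y = 0.
Proof.
move=> tX byy h; have [y' _ yy'] := bop_adj byy.
have V k : exists2 v, bop v & adj (fun x => tau x k) v.
  exact: bop_adj (tensor_bop tauP' k).
have y0 x k : X x -> y (tau x k) = 0.
  move=> Xx; apply: (tensor_ext0 tauP) => x' k'; have [v bv hv] := V k'.
  apply: inner_eq0C; rewrite hv (_ : v _ = 0) ?inner0r //.
  by apply: tX => x1 X1; rewrite -hv; apply: inner_eq0C; exact: h.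
apply/funext => z; apply: inner_ext => u; rewrite yy' inner0l.
rewrite (_ : y' u = 0) ?inner0r //; apply: (tensor_ext0 tauP) => x k.
have [v bv hv] := V k; apply: inner_eq0C; rewrite hv (_ : v _ = 0) ?inner0r //.
by apply: tX => x1 X1; rewrite -hv -yy' y0 // inner0l.
Qed.

(** The bimodule property of slice maps over 1 (x) B(K), in matrix coefficients. *)
Lemma lift_slice b c t x x' k k' : bop b -> is_lift tau b c ->
  inner (t (c (tau x k))) (tau x' k') = inner (slice tau x x' t (b k)) k' /\
  inner (c (t (tau x k))) (tau x' k') = inner (b (slice tau x x' t k)) k'.
Proof.
move=> bb hc; have [bc cE] := hc.
have [b' bb' hb'] := bop_adj bb; have [c' bc' hc'] := bop_adj bc.
have [_ cE'] := is_lift_adj tauP hb' hc bc' hc'.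
by rewrite cE hc' cE' hb' !(sliceP tauP).
Qed.

Lemma commute_slice b c t x x' : bop b -> is_lift tau b c ->
  t \o c = c \o t -> slice tau x x' t \o b = b \o slice tau x x' t.
Proof.
move=> bb hc tc; apply/funext => k; apply: inner_ext => k' /=.
have [h1 h2] := lift_slice t x x' k k' bb hc.
by rewrite -h1 -h2; have /funeqP/(_ (tau x k)) /= -> := tc.
Qed.

(** Converse of [commute_slice]: slices along a total set determine an operator, hence detect
    commutation. *)
Lemma slice_commute (X : set H) b c t : total_set X -> bop t -> bop b -> is_lift tau b c ->
  (forall x x', X x -> X x' -> slice tau x x' t \o b = b \o slice tau x x' t) ->
  t \o c = c \o t.
Proof.
move=> tX bt bb hc h; have [bc _] := hc.
have : (t \o c) - (c \o t) = 0.
  apply: (total_eq0 tX).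
    by apply: bop_sub; exact: bop_comp.
  move=> x x' k k' Xx Xx'; have [h1 h2] := lift_slice t x x' k k' bb hc.
  rewrite !fctE /= innerBl h1 h2.
  by have /funeqP/(_ k) /= -> := h _ _ Xx Xx'; rewrite subrr.
by move/eqP; rewrite subr_eq0 => /eqP.
Qed.

Lemma total_setT : total_set [set: H].
Proof. by move=> h hh; apply: inner_ext => x; rewrite inner0l innerC hh // conjC0. Qed.

End SliceCommute.
End Tensor.

(** * Generators of tensor products *)

Section TensorGenerators.
Variables (R : realType) (H K : hilbertType R) (T : hilbert_tensor H K).
Variables (A : set (H -> H)) (P : set (K -> K)).
Hypotheses (Ab : A `<=` @bounded_op R H) (Aid : A id) (vP : is_vonNeumann P).

Local Notation tau := (fun x y => tensor T x y).
Let tauP := hilbert_tensorP T.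
Let tauP' := is_tensor_swap tauP.

Definition elementary_ops : set (T -> T) := [set c | bounded_op c /\
    exists a b, [/\ A a, P b &
      forall x y, c (tensor T x y) = tensor T (a x) (b y)]].

Lemma elementary_bounded : elementary_ops `<=` @bounded_op R T.
Proof. by move=> c []. Qed.

Lemma vn_tensor_vn : is_vonNeumann (vn_tensor T A P).
Proof. exact: vn_generatedP elementary_bounded. Qed.

Lemma lift_elementary b c : P b -> is_lift tau b c -> elementary_ops c.
Proof.
move=> Pb [bc hc]; split; first exact/bop_bounded_op.
by exists id, b.
Qed.

Lemma lift_elementary_l a c : A a -> is_lift (fun y x => tau x y) a c ->
  elementary_ops c.
Proof.
move=> Aa [bc hc]; split; first exact/bop_bounded_op.
by exists a, id; split=> //; exact: vn_id.
Qed.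

Lemma lift_mem b c : P b -> is_lift tau b c -> vn_tensor T A P c.
Proof. by move=> Pb hc; apply: sub_vn_generated; exact: lift_elementary hc. Qed.

(** The elementary inclusion of the commutation theorem: it is clear on elementary operators, and
    the commutant of the self-adjoint set 1 (x) P' is a von Neumann algebra. *)
Lemma tensor_commutes_lift t b c : vn_tensor T A P t -> commutant P b ->
  is_lift tau b c -> t \o c = c \o t.
Proof.
move=> Mt Pb hc.
pose S : set (T -> T) := [set c | exists2 b, commutant P b & is_lift tau b c].
have Sb : S `<=` @bounded_op R T by move=> u [v _ [bu _]]; exact/bop_bounded_op.
have Ss : sa_closed S.
  move=> u [v Pv hu]; have [v' Pv' vv'] := commutant_sa_closed (vn_sa_closed vP) Pv.
  have [u' bu' uu'] := bop_adj (proj1 hu).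
  by exists u' => //; exists v' => //; exact: (is_lift_adj tauP vv' hu bu' uu').
have : vn_tensor T A P `<=` commutant S.
  apply: vn_generated_min; first exact: vn_commutant.
  move=> u [bu [a [v [Aa Pv uE]]]]; split=> // w [q [bq Pq] [bw wE]].
  have bu' : bop u by exact/bop_bounded_op.
  apply: (bop_ext tauP); [exact: bop_comp|exact: bop_comp|move=> x y /=].
  rewrite wE !uE wE; congr (tensor T _ _).
  by have /funeqP/(_ y) /= := Pq _ Pv.
by move=> /(_ _ Mt) [_ ->] //; exists b.
Qed.

Lemma slice_mem xi eta t : vn_tensor T A P t -> P (slice tau xi eta t).
Proof.
move=> Mt; have bt := vn_bop vn_tensor_vn Mt.
apply: (vn_mem vP); first exact: slice_bop.
move=> b Pb; have bb : bop b by apply/bop_bounded_op; case: Pb.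
have [c hc] := lift_ex tauP bb.
exact: (commute_slice tauP _ _ bb hc (tensor_commutes_lift Mt Pb hc)).
Qed.

Lemma slices_generate (X : set H) (S : set (T -> T)) (xi0 : H) : xi0 != 0 ->
  total_set X -> vn_generated S = vn_tensor T A P ->
  vn_generated [set b | exists xi eta t, [/\ X xi, X eta, S t & b = slice tau xi eta t]] = P.
Proof.
move=> xi0N tX SE; have SM : S `<=` vn_tensor T A P by rewrite -SE; exact: sub_vn_generated.
rewrite eqEsubset; split.
  by apply: vn_generated_min => // _ [xi [eta [t [_ _ St ->]]]]; exact: slice_mem (SM _ St).
move=> b Pb Q vQ SQ.
have bb := vn_bop vP Pb.
apply: (vn_mem vQ bb) => q Qq.
have bq : bop q by apply/bop_bounded_op; case: Qq.
have [c hc] := lift_ex tauP bb; have [d hd] := lift_ex tauP bq.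
pose U : set (T -> T) := [set d | exists2 q, commutant Q q & is_lift tau q d].
have Ub : U `<=` @bounded_op R T by move=> u [v _ [bu _]]; exact/bop_bounded_op.
have Us : sa_closed U.
  move=> u [v Qv hu]; have [v' Qv' vv'] := commutant_sa_closed (vn_sa_closed vQ) Qv.
  have [u' bu' uu'] := bop_adj (proj1 hu).
  by exists u' => //; exists v' => //; exact: (is_lift_adj tauP vv' hu bu' uu').
have MU : vn_tensor T A P `<=` commutant U.
  rewrite -SE; apply: vn_generated_min; first exact: vn_commutant.
  move=> t St; have bt := vn_bop vn_tensor_vn (SM _ St).
  split=> [|u [v Qv hv]]; first exact/bop_bounded_op.
  have bv : bop v by apply/bop_bounded_op; case: Qv.
  apply: (slice_commute tauP tX bt bv hv) => x x' Xx Xx'.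
  by case: Qv => _ ->//; apply: SQ; exists x, x', t.
have [_ /(_ d)] := MU _ (lift_mem Pb hc).
have Ud : U d by exists q.
move=> /(_ Ud) cd; apply/funext => k /=; apply/eqP; rewrite -subr_eq0.
have cE x y : c (tensor T x y) = tensor T x (b y) by case: hc => _ /(_ x y).
have dE x y : d (tensor T x y) = tensor T x (q y) by case: hd => _ /(_ x y).
(* Tensoring with a nonzero vector is injective, so commutation of the lifts descends to [b] and
   [q]. *)
have : tensor T xi0 (b (q k) - q (b k)) = 0.
  rewrite (bopB _ _ (tensor_bop tauP xi0)) /= -cE -!dE -cE.
  by have /funeqP/(_ (tensor T xi0 k)) /= -> := cd; rewrite subrr.
move=> /(congr1 (fun z => inner z z)); rewrite inner0l inner_tensor => /eqP.
by rewrite mulf_eq0 !dnorm_eq0 (negbTE xi0N).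
Qed.

(** [f n] is a_n (x) 1 and [g p] is 1 (x) p. An elementary operator factors as c1 c2 with one
    trivial leg each. For [c1] the matrix coefficients of both products with [t] are vector
    functionals at a', to which the separation hypothesis applies; for [c2] the slices of [t]
    commute with [S], hence with [P]. *)
Lemma tensor_generated (a : nat -> H -> H) (S : set (K -> K)) :
  (forall n, A (a n)) ->
  (forall x y x' y', (forall n, inner (a n x) y = inner (a n x') y') ->
     forall b, A b -> inner (b x) y = inner (b x') y') ->
  vn_generated S = P ->
  exists (f : nat -> T -> T) (g : (K -> K) -> T -> T),
    range f `|` [set g p | p in S] `<=` vn_tensor T A P /\
    vn_generated (range f `|` [set g p | p in S]) = vn_tensor T A P.
Proof.
move=> Aa sep SE; have SP : S `<=` P by rewrite -SE; exact: sub_vn_generated.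
have /choice [f hf] : forall n, exists c, is_lift (fun y x => tau x y) (a n) c.
  by move=> n; apply: (lift_ex tauP'); apply/bop_bounded_op/Ab.
have /choice [g hg] : forall p, exists c, S p -> is_lift tau p c.
  move=> p; have [Sp|nS] := pselect (S p); last by exists id.
  by have [c hc] := lift_ex tauP (vn_bop vP (SP _ Sp)); exists c.
exists f, g; set G := _ `|` _.
have GM : G `<=` vn_tensor T A P.
  move=> _ [[n _ <-]|[p Sp <-]].
    by apply: sub_vn_generated; exact: lift_elementary_l (hf n).
  exact: lift_mem (SP _ Sp) (hg _ Sp).
split=> //; rewrite eqEsubset; split; first exact: vn_generated_min vn_tensor_vn GM.
move=> c Mc N vN GN; move: c Mc.
apply: (vn_generated_min vN) => c [/bop_bounded_op bc [a' [b [Aa' Pb cE]]]].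
apply: (vn_mem vN bc) => t Nt.
have bt : bop t by apply/bop_bounded_op; case: Nt.
have [t' Nt' tt'] := commutant_sa_closed (vn_sa_closed vN) Nt.
have [c1 [bc1 c1E]] := lift_ex tauP' (proj1 (bop_bounded_op _) (Ab Aa')).
have bb := vn_bop vP Pb.
have [c2 [bc2 c2E]] := lift_ex tauP bb.
have -> : c = c1 \o c2.
  by apply: (bop_ext tauP) => // [|x y /=]; [exact: bop_comp|rewrite cE c2E c1E].
have /choice [v hv] : forall k, exists v, adj (fun x => tau x k) v.
  by move=> k; have [v _ hv] := bop_adj (tensor_bop tauP' k); exists v.
have coef al ga x k y k' : bop al -> is_lift (fun y x => tau x y) al ga ->
    inner (t (ga (tau x k))) (tau y k') = inner (al x) (v k (t' (tau y k'))) /\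
    inner (ga (t (tau x k))) (tau y k') = inner (al (v k' (t (tau x k)))) y.
  move=> bal hga; have [bga gaE] := hga.
  have [al' _ hal'] := bop_adj bal; have [ga' bga' hga'] := bop_adj bga.
  have [_ gaE'] := is_lift_adj tauP' hal' hga bga' hga'.
  split; first by rewrite gaE tt' hv.
  by rewrite hga' gaE' hal' innerC hv -innerC.
have tc1 : t \o c1 = c1 \o t.
  apply/funext => z; apply/funeqP: z.
  apply: (bop_ext tauP); [exact: bop_comp|exact: bop_comp|move=> x k /=].
  apply: (tensor_ext tauP) => y k'.
  have ba' : bop a' by apply/bop_bounded_op/Ab.
  have [-> ->] := coef _ _ x k y k' ba' (conj bc1 c1E).
  apply: sep => // n; have ba : bop (a n) by apply/bop_bounded_op/Ab.
  have [<- <-] := coef _ _ x k y k' ba (hf n).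
  by case: Nt => _ /(_ (f n)) /(_ _)/funeqP/(_ (tau x k)) /= -> //; apply: GN; left; exists n.
have tc2 : t \o c2 = c2 \o t.
  (* The slices of the adjoint are included so that [S1] is self-adjoint and its commutant a von
     Neumann algebra. *)
  pose S1 : set (K -> K) := [set u | exists xi eta,
    u = slice tau xi eta t \/ u = slice tau xi eta t'].
  have bt' : bop t' by apply/bop_bounded_op; case: Nt'.
  have vS1 : is_vonNeumann (commutant S1).
    apply: vn_commutant => [u [xi [eta [->|->]]]|u [xi [eta [->|->]]]].
    - by apply/bop_bounded_op; exact: (slice_bop tauP).
    - by apply/bop_bounded_op; exact: (slice_bop tauP).
    - by exists (slice tau eta xi t'); [exists eta, xi; right|exact: (slice_adj tauP)].
    - exists (slice tau eta xi t); first by exists eta, xi; left.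
      by apply: (slice_adj tauP); exact: adj_sym.
  have PS1 : P `<=` commutant S1.
    rewrite -SE; apply: vn_generated_min => // p Sp.
    have bp : bop p := vn_bop vP (SP _ Sp).
    split=> [|u [xi [eta]]]; first exact/bop_bounded_op.
    have Ng : N (g p) by apply: GN; right; exists p.
    case=> ->; apply/esym; apply: (commute_slice tauP _ _ bp (hg _ Sp)).
      exact: vn_commute Ng Nt.
    exact: vn_commute Ng Nt'.
  apply: (slice_commute tauP (@total_setT _ _) bt bb (conj bc2 c2E)) => x x' _ _.
  have [_ h] := PS1 _ Pb; apply/esym/h; exists x, x'; by left.
by rewrite -compA -tc2 compA -tc1 compA.
Qed.

End TensorGenerators.

(** * Cardinality *)

Section Cardinality.
Local Open Scope card_scope.

Lemma card_le_inj (T U : Type) (f : T -> U) : injective f ->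
  [set: T] #<= [set: U].
Proof.
move=> fi; have : f @` [set: T] #= [set: T] by apply: inj_card_eq => x y _ _; exact: fi.
move=> /card_eqPle [_ h]; exact: (card_le_trans h (card_leT _)).
Qed.

Lemma card_le_fun (T U : Type) (u0 : U) (A : set T) (B : set U) : A #<= B ->
  exists f : T -> U, (forall x, A x -> B (f x)) /\
    forall x y, A x -> A y -> f x = f y -> x = y.
Proof.
move=> /card_leP [g].
have /choice [f hf] : forall x, exists u, forall Ax : x \in A, u = set_val (g (SigSub Ax)).
  move=> x; have [Ax|nA] := pselect (x \in A); last by exists u0.
  exists (set_val (g (SigSub Ax))) => Ax'; congr (set_val (g _)); exact: val_inj.
exists f; split=> [x /mem_set Ax|x y /mem_set Ax /mem_set Ay].
  by rewrite (hf _ Ax); exact: set_valP.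
rewrite (hf _ Ax) (hf _ Ay) => /val_inj /(@inj _ _ _ g).
by move=> /(_ (mem_set I) (mem_set I)) /(congr1 val).
Qed.

(* A maximal family of injective sequences with disjoint ranges covers all but
   finitely many elements of kappa. *)
Lemma card_nat_mul (kappa : Type) : infinite_set [set: kappa] ->
  [set: nat * kappa] #<= [set: kappa].
Proof.
move=> kinf.
pose P : set (set (nat -> kappa)) := [set F : set (nat -> kappa) |
  (forall f : nat -> kappa, F f -> injective f) /\
  (forall f g i j, F f -> F g -> f i = g j -> f = g)].
have [F [[Fi Fd] Fmax]] : exists F : set (nat -> kappa), P F /\ forall G, F `<` G -> ~ P G.
  apply: Zorn_bigcup => FF FP tot; split=> [f [X FX Xf]|f g i j [X FX Xf] [Y FY Yg]].
    by case: (FP _ FX) => h _; exact: h.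
  by case: (tot _ _ FX FY) => XY; [have [_ h] := FP _ FY|have [_ h] := FP _ FX];
    apply: h => //; exact: XY.
pose D := [set x | ~ exists2 f, F f & exists i, f i = x].
have Dfin : finite_set D.
  apply: contrapT => /infiniteP.
  have [x0 _] := infinite_setN0 kinf.
  move=> /(card_le_fun x0) [g [gD' gi']].
  have gD i : D (g i) by exact: gD'.
  have gi : injective g by move=> i j; exact: gi'.
  have Fg : ~ F g by move=> Fg; apply: (gD 0%N); exists g => //; exists 0%N.
  apply: (Fmax (F `|` [set (g : nat -> kappa)])).
    split; first by move=> f; left.
    by move=> /(_ g) h; apply: Fg; apply: h; right.
  split=> [f [/Fi//|->]//|f f' i j [Ff|->] [Ff'|->] //].
  - exact: Fd.
  - by move=> e; case: (gD j); exists f => //; exists i.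
  - by move=> e; case: (gD i); exists f' => //; exists j.
have [f0 Ff0] : F !=set0.
  apply: contrapT => F0; apply: kinf.
  have -> : [set: kappa] = D; last by [].
  by rewrite eqEsubset; split=> // x _ [f Ff _]; apply: F0; exists f.
have /countable_injP [d dinj] := finite_set_countable Dfin.
have /choice [c hc] : forall x, exists p : (nat -> kappa) * nat * bool,
    F p.1.1 /\ if p.2 then D x /\ p.1.2 = d x else p.1.1 p.1.2 = x.
  move=> x; have [Dx|nD] := pselect (D x); first by exists (f0, d x, true).
  have [f Ff [i fx]] : exists2 f, F f & exists i, f i = x by exact: contrapT nD.
  by exists (f, i, false).
(* A point x = f i is sent, together with m, to the same sequence f at an even index coding (m, i).
   The finitely many leftover points, coded by [d], use odd indices, so the two kinds cannot
   collide. *)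
pose h (p : nat * kappa) : kappa :=
  (c p.2).1.1 ((pickle (p.1, (c p.2).1.2)).*2 + (c p.2).2)%N.
apply: (@card_le_inj _ _ h) => -[m x] [n y]; rewrite /h /=.
have := hc x; have := hc y.
case: (c x) => [[f i] b]; case: (c y) => [[g j] b'] /= [Fg hy] [Ff hx] e.
have fg := Fd _ _ _ _ Ff Fg e; move: fg hx hy e => -> hx hy /(Fi _ Fg) e.
have eb : b = b'.
  by move/(congr1 odd): e; rewrite !oddD !odd_double; case: b {hx}; case: b' {hy}.
move: hx hy e; rewrite eb => hx hy /eqP; rewrite eqn_add2r => /eqP /double_inj.
move=> /(pcan_inj pickleK) [-> ij]; congr (_, _); move: hx hy; rewrite ij.
case: b' {eb} => [[Dx ->] [Dy]|<- <- //].
by apply: dinj; exact/mem_set.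
Qed.

Lemma card_le_surj (kappa T : Type) (k0 : kappa) (t0 : T) (S : set T) :
  S #<= [set: kappa] -> exists e : kappa -> T, S `<=` range e.
Proof.
move=> /(card_le_fun k0) [f [_ fi]].
have /choice [e he] : forall k, exists t, forall s, S s -> f s = k -> t = s.
  move=> k; have [[s Ss fs]|n] := pselect (exists2 s, S s & f s = k).
    by exists s => s' Ss' fs'; apply: fi => //; rewrite fs.
  by exists t0 => s Ss fs; case: n; exists s.
by exists e => s Ss; exists (f s) => //; exact: he.
Qed.

Lemma card_le_range (kappa T : Type) (S : set T) (h : nat * kappa -> T) :
  infinite_set [set: kappa] -> S `<=` range h -> S #<= [set: kappa].
Proof.
move=> kinf Sh; apply: card_le_trans (card_nat_mul kinf).
exact: card_le_trans (subset_card_le Sh) (card_image_le _ _).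
Qed.

End Cardinality.

(** * Separable algebras *)

Section SeparableAlgebra.
Variables (R : realType) (H : hilbertType R) (M : set (H -> H)).
Hypotheses (Mb : M `<=` @bounded_op R H) (Mid : M id).
Hypothesis (MZ : forall (c : R[i]) a, M a -> M (c *: a)).

Lemma series_two (u : nat -> R[i]) n : (forall k, u k.+2 = 0) ->
  series u n.+2 = u 0%N + u 1%N.
Proof.
move=> u0; rewrite /series /= big_nat_recl // big_nat_recl // big1 ?addr0 //.
Qed.

Lemma predual_vector_diff (x y x' y' : H) :
  predual M (fun a => inner (a x) y - inner (a x') y').
Proof.
pose X n : H := match n with 0%N => x | 1%N => x' | _ => 0 end.
pose Y n : H := match n with 0%N => y | 1%N => - y' | _ => 0 end.
have near2 (u : nat -> R[i]) (l : R[i]) : (forall k, u k.+2 = 0) -> u 0%N + u 1%N = l ->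
    \forall n \near \oo, series u n = l.
  by move=> u0 ul; exists 2%N => // -[|[|n]] //= _; rewrite series_two.
exists X, Y; split.
- apply: (@is_cvg_near_cst _ _ (`|x| ^+ 2 + `|x'| ^+ 2 : R[i]^o)).
  by apply: near2 => // k; rewrite /= normr0 expr0n.
- apply: (@is_cvg_near_cst _ _ (`|y| ^+ 2 + `|- y'| ^+ 2 : R[i]^o)).
  by apply: near2 => // k; rewrite /= normr0 expr0n.
- move=> a Ma; apply: cvg_near_cst; apply: near2 => [k|] /=.
    by rewrite inner0r.
  by rewrite innerNr.
Qed.

Lemma norm_le_nn (x y : H) : (`|x| <= `|y|) = (nn x <= nn y).
Proof. by rewrite -lecR -!norm_nn ler_pXn2r // nnegrE. Qed.

(** For each n and m the sequence contains a point of the unit ball where |f_n| exceeds 1 / (m + 1),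
    if there is one. Let phi be a difference of vector functionals vanishing on the sequence, and
    f_n within 1 / (m + 1) of it. Then |f_n| cannot exceed 1 / (m + 1) at the chosen point, hence
    nowhere on the ball, and |phi| <= 2 / (m + 1) there. *)
Lemma separating_sequence : vn_separable M -> exists a : nat -> H -> H,
  (forall n, M (a n)) /\
  forall x y x' y', (forall n, inner (a n x) y = inner (a n x') y') ->
     forall b, M b -> inner (b x) y = inner (b x') y'.
Proof.
move=> [f fP fD].
pose B (a : H -> H) := M a /\ forall x : H, `|a x| <= `|x|.
have /choice [a ha] : forall p : nat * nat, exists a, B a /\
    ((exists2 b, B b & (p.2.+1%:R^-1 : R)%:C < `|f p.1 b|) ->
      (p.2.+1%:R^-1 : R)%:C < `|f p.1 a|).
  move=> p; have [[b Bb hb]|n] := pselect (exists2 b, B b & (p.2.+1%:R^-1 : R)%:C < `|f p.1 b|).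
    by exists b.
  by exists id; split=> //; split.
exists (fun n => a (odflt (0%N, 0%N) (unpickle n))); split.
  by move=> n; case: (ha (odflt (0%N, 0%N) (unpickle n))) => -[].
move=> x y x' y' hn b Mb'.
pose phi (a : H -> H) := inner (a x) y - inner (a x') y'.
have phia p : phi (a p) = 0.
  by have := hn (pickle p); rewrite pickleK /= /phi => ->; rewrite subrr.
have phiB c : B c -> phi c = 0.
  move=> Bc; apply/eqP; rewrite -normr_eq0.
  have nR : `|phi c| = (complex.Re `|phi c|)%:C by rewrite RRe_real // realE normr_ge0.
  rewrite nR (_ : complex.Re _ = 0) //; apply/eqP; rewrite eq_le; apply/andP; split; last first.
    by rewrite -lecR -nR; exact: normr_ge0.
  apply/ler_addgt0Pl => e e0; rewrite addr0.
  have [m hm] := invn_le (divr_gt0 e0 (ltr0Sn R 1)).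
  have := hm m (leqnn _); set r : R := m.+1%:R^-1 => rle.
  have r0 : (0 : R[i]) < r%:C by rewrite ltcR invr_gt0.
  have [n hn'] := fD _ (predual_vector_diff x y x' y') _ r0.
  have fle d : B d -> `|f n d| <= r%:C.
    move=> Bd; rewrite real_leNgt ?realE ?normr_ge0 // ?(ltW r0) //.
    apply/negP => lt.
    have [Ba] := ha (n, m); have ex : exists2 b, B b & r%:C < `|f n b| by exists d.
    move=> /(_ ex) /=; have := hn' _ (proj1 Ba) (proj2 Ba).
    rewrite -/(phi _) phia sub0r normrN => h1 h2.
    by have := lt_le_trans h2 h1; rewrite ltxx.
  have : `|phi c| <= (r + r)%:C.
    rewrite rmorphD /= -[phi c](subrK (f n c)).
    apply: (le_trans (ler_normD _ _)); apply: lerD; last exact: fle.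
    by apply: hn'; case: Bc.
  by rewrite nR lecR; lra.
have bb : bop b by apply/bop_bounded_op/Mb.
have [_ [C C0 hC]] := bb.
(* [C] bounds the squared norm and k^2 C <= 1, so k b is in the unit ball. *)
pose k : R := (C + 1)^-1; have k0 : 0 < k by rewrite invr_gt0; lra.
have kC : k * (C + 1) = 1 by rewrite mulVf // gt_eqF //; lra.
have Bkb : B (k%:C *: b).
  split; first exact: MZ.
  move=> z; rewrite norm_le_nn fctE nnZ /= expr0n /= addr0.
  have := hC z; have := nn_ge0 z; have := nn_ge0 (b z) => h1 h2 h3.
  have : k ^+ 2 * nn (b z) <= k ^+ 2 * (C * nn z) by rewrite ler_wpM2l // sqr_ge0.
  move=> h4; apply: (le_trans h4).
  have -> : k ^+ 2 * (C * nn z) = k * (k * C) * nn z by ring.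
  have kC0 : 0 <= k * C by rewrite mulr_ge0 // ltW.
  have [k1 kC1] : k <= 1 /\ k * C <= 1 by split; lra.
  by rewrite ler_piMl // mulr_ile1 // ltW.
have := phiB _ Bkb; rewrite /phi !fctE !innerZl -mulrBr => /eqP.
rewrite mulf_eq0 subr_eq0 => /orP[|/eqP //].
by rewrite eq_complex /= eqxx andbT gt_eqF.
Qed.

End SeparableAlgebra.

(** * Multiplication operators on square integrable functions *)

Section MultiplicationAlgebra.
Variables (R : realType) (d : measure_display) (T : measurableType d).
Variables (mu : probability T R) (L : L2space mu).
Implicit Types (f g u : T -> R[i]) (v w : T -> R).

Local Notation cL2 := (cLfun mu 2%:E).
Local Notation cls := (L2_class L).

Lemma Lfun_measurable (p : \bar R) v : v \in Lfun mu p -> measurable_fun setT v.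
Proof. by rewrite inE => /andP[]; rewrite inE. Qed.

Lemma Lfun2E v : v \in Lfun mu 2%:E <->
  measurable_fun setT v /\ mu.-integrable setT (EFin \o (fun x => v x ^+ 2)).
Proof.
split=> [hv|[mv iv]].
  by split; [exact: Lfun_measurable hv|exact: Lfun2_integrable_sqr].
rewrite inE; apply/andP; split; rewrite inE //= /finite_norm unlock.
apply: poweR_lty; case/integrableP: iv => _.
apply: le_lt_trans; apply: ge0_le_integral => //.
- by move=> x _; exact: poweR_ge0.
- apply/measurable_EFinP.
  apply: (@measurableT_comp _ _ _ _ _ _ (fun x : R => x `^ 2)%R) => //.
  exact/measurableT_comp.
- by apply: measurableT_comp => //; apply/measurable_EFinP; exact: measurable_funX.
- by move=> x _ /=; rewrite lee_fin normrX powR_mulrn.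
Qed.

Lemma eq_Lfun (p : \bar R) v w : v =1 w -> v \in Lfun mu p -> w \in Lfun mu p.
Proof. by move=> /funext ->. Qed.

Lemma Lfun_lin (p : \bar R) (p1 : (1 <= p)%E) (a b : R) v w :
  v \in Lfun mu p -> w \in Lfun mu p -> (fun x => a * v x + b * w x) \in Lfun mu p.
Proof.
move=> hv hw; have [h0 hl] := Lfun_submod_closed mu p1.
have := hl b w 0 hw h0; rewrite addr0 => hbw.
exact: (hl a v (b *: w) hv hbw).
Qed.

Lemma LfunooP v : v \in Lfun mu +oo%E <-> measurable_fun setT v /\
  exists C : R, \forall x \ae mu, `|v x| <= C.
Proof.
have mu0 : (0 < mu setT)%E by rewrite probability_setT.
split=> [hv|[mv [C hC]]].
  split; first exact: Lfun_measurable hv.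
  move: hv; rewrite inE => /andP[_]; rewrite inE /= /finite_norm unlock mu0.
  by move=> /ess_supr_bounded [C hC]; exists C.
rewrite inE; apply/andP; split; rewrite inE //= /finite_norm unlock mu0.
apply: (@le_lt_trans _ _ C%:E); last exact: ltry.
by apply/ess_supP; apply: filterS hC => x /=; rewrite lee_fin.
Qed.

Lemma mul_Lfun v w : v \in Lfun mu +oo%E -> w \in Lfun mu 2%:E ->
  (fun x => v x * w x) \in Lfun mu 2%:E.
Proof.
move=> /LfunooP [mv [C hC]] /Lfun2E [mw iw]; apply/Lfun2E.
have mvw : measurable_fun setT (fun x => v x * w x) by exact: measurable_funM.
split=> //.
have iCw : mu.-integrable setT (EFin \o (fun x => C ^+ 2 * w x ^+ 2)).
  by have := integrableZl measurableT (C ^+ 2) iw.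
case/integrableP: iCw => mCw iCw; apply/integrableP; split.
  by apply/measurable_EFinP; exact: measurable_funX.
apply: le_lt_trans iCw; apply: ae_ge0_le_integral => //.
- by apply: measurableT_comp => //; apply/measurable_EFinP; exact: measurable_funX.
- exact: measurableT_comp.
- apply: filterS hC => x; rewrite ler_norml => /andP[h1 h2] _ /=.
  have vC : v x ^+ 2 <= C ^+ 2 by nra.
  rewrite lee_fin [leLHS]ger0_norm ?sqr_ge0 // [leRHS]ger0_norm.
    by have := ler_wpM2r (sqr_ge0 (w x)) vC; rewrite -exprMn.
  by rewrite mulr_ge0 ?sqr_ge0.
Qed.

Lemma cLfunP (p : \bar R) f :
  cLfun mu p f <-> (fun x => complex.Re (f x)) \in Lfun mu p /\
                   (fun x => complex.Im (f x)) \in Lfun mu p.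
Proof. by []. Qed.

Lemma cLfun_lin (p : \bar R) (p1 : (1 <= p)%E) (c : R[i]) f g :
  cLfun mu p f -> cLfun mu p g -> cLfun mu p (fun x => c * f x + g x).
Proof.
move=> /cLfunP[fr fi] /cLfunP[gr gi]; apply/cLfunP; split.
- have := Lfun_lin p1 1 1 (Lfun_lin p1 (complex.Re c) (- complex.Im c) fr fi) gr.
  apply: eq_Lfun => x.
  by case: c => a b; case: (f x) => ? ?; case: (g x) => ? ? /=; ring.
- have := Lfun_lin p1 1 1 (Lfun_lin p1 (complex.Im c) (complex.Re c) fr fi) gi.
  apply: eq_Lfun => x.
  by case: c => a b; case: (f x) => ? ?; case: (g x) => ? ? /=; ring.
Qed.

Lemma cLfun_mul f g : cLfun mu +oo%E f -> cL2 g -> cL2 (fun x => f x * g x).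
Proof.
have p1 : (1 <= 2%:E :> \bar R)%E by rewrite lee_fin ler1n.
move=> /cLfunP[fr fi] /cLfunP[gr gi]; apply/cLfunP; split.
- have := Lfun_lin p1 1 (-1) (mul_Lfun fr gr) (mul_Lfun fi gi).
  apply: eq_Lfun => x.
  by case: (f x) => ? ?; case: (g x) => ? ? /=; ring.
- have := Lfun_lin p1 1 1 (mul_Lfun fr gi) (mul_Lfun fi gr).
  apply: eq_Lfun => x.
  by case: (f x) => ? ?; case: (g x) => ? ? /=; ring.
Qed.

Lemma Lfunoo_bounded v : measurable_fun setT v -> (forall x, `|v x| <= 1) ->
  v \in Lfun mu +oo%E.
Proof. by move=> mv v1; apply/LfunooP; split=> //; exists 1; apply: nearW. Qed.

Lemma cLfun_cst (c : R[i]) : cL2 (fun=> c).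
Proof. by apply/cLfunP; split; exact: Lfun_cst. Qed.

Lemma cLfunoo_real v : measurable_fun setT v -> (forall x, `|v x| <= 1) ->
  cLfun mu +oo%E (fun x => (v x)%:C).
Proof.
move=> mv v1; apply/cLfunP; split; first exact: Lfunoo_bounded.
by apply: Lfunoo_bounded => [|x]; [exact: measurable_cst|rewrite /= normr0].
Qed.

Lemma nn_class f : cL2 f ->
  nn (cls f) = \int[mu]_x (complex.Re (f x) ^+ 2 + complex.Im (f x) ^+ 2).
Proof.
move=> hf; rewrite /nn /rp L2_class_inner //=; apply: eq_Rintegral => x _ /=.
by case: (f x) => a b /=; ring.
Qed.

Lemma integrable_sqr f : cL2 f -> mu.-integrable setT
  (EFin \o (fun x => complex.Re (f x) ^+ 2 + complex.Im (f x) ^+ 2)).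
Proof.
move=> /cLfunP[/Lfun2_integrable_sqr h1 /Lfun2_integrable_sqr h2].
by have := integrableD measurableT h1 h2.
Qed.

Lemma nn_class_mul v f : measurable_fun setT v -> (forall x, `|v x| <= 1) ->
  cL2 f -> nn (cls (fun x => (v x)%:C * f x)) <= nn (cls f).
Proof.
move=> mv v1 hf; have hvf := cLfun_mul (cLfunoo_real mv v1) hf.
rewrite !nn_class //; apply: le_Rintegral => //; try exact: integrable_sqr.
move=> x _; have := v1 x; rewrite ler_norml => /andP[l1 l2].
have : v x ^+ 2 <= 1 by nra.
case: (f x) => a b /=; have := sqr_ge0 a; have := sqr_ge0 b; nra.
Qed.

Lemma classB f g : cL2 f -> cL2 g -> cls (fun x => f x - g x) = cls f - cls g.
Proof.
move=> hf hg; have := L2_class_linear L (-1) hg hf; rewrite scaleN1r addrC => <-.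
by congr L2_class; apply/funext => x; rewrite mulN1r addrC.
Qed.

(** The operator is defined on representatives; the estimate [nn_class_mul] gives independence of
    the choice as well as boundedness. *)
Lemma mult_op v : measurable_fun setT v -> (forall x, `|v x| <= 1) ->
  exists b, Linfty L b /\
    forall f, cL2 f -> b (cls f) = cls (fun x => (v x)%:C * f x).
Proof.
move=> mv v1; have voo := cLfunoo_real mv v1.
have /choice [r hr] : forall h : L, exists f, cL2 f /\ cls f = h.
  by move=> h; have [f hf <-] := L2_class_surj h; exists f.
have rL h : cL2 (r h) by case: (hr h).
have rE h : cls (r h) = h by case: (hr h).
pose b (h : L) : L := cls (fun x => (v x)%:C * r h x).
have p1 : (1 <= 2%:E :> \bar R)%E by rewrite lee_fin ler1n.
have hb f : cL2 f -> b (cls f) = cls (fun x => (v x)%:C * f x).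
  move=> hf; apply/eqP; rewrite -subr_eq0; apply/eqP/nn_eq0/eqP.
  rewrite eq_le nn_ge0 andbT /b -classB; [|exact: cLfun_mul|exact: cLfun_mul].
  have hrf : cL2 (fun x => r (cls f) x - f x).
    have -> : (fun x => r (cls f) x - f x) = (fun x => -1 * f x + r (cls f) x).
      by apply/funext => x; rewrite mulN1r addrC.
    exact: cLfun_lin.
  have -> : (fun x => (v x)%:C * r (cls f) x - (v x)%:C * f x) =
      (fun x => (v x)%:C * (r (cls f) x - f x)).
    by apply/funext => x; rewrite mulrBr.
  by apply: (le_trans (nn_class_mul mv v1 hrf)); rewrite classB // rE subrr nn0.
have bb : bop b.
  split=> [c h k|].
    rewrite -{1}(rE h) -{1}(rE k) -L2_class_linear // hb; last exact: cLfun_lin.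
    rewrite /b -L2_class_linear; [|exact: cLfun_mul|exact: cLfun_mul].
    by congr L2_class; apply/funext => x; ring.
  exists 1 => // h; rewrite mul1r /b -{2}(rE h); exact: nn_class_mul.
exists b; split=> //; split; first exact/bop_bounded_op.
by exists (fun x => (v x)%:C).
Qed.

Lemma Linfty_bounded : Linfty L `<=` @bounded_op R L.
Proof. by move=> a []. Qed.

Lemma Linfty_id : Linfty L id.
Proof.
split; first by apply/bop_bounded_op; exact: bop_id.
exists (fun x => (1 : R)%:C); first by apply: cLfunoo_real => // x; rewrite normr1.
by move=> g hg /=; congr L2_class; apply/funext => x; rewrite mul1r.
Qed.

Lemma Linfty_scale (c : R[i]) a : Linfty L a -> Linfty L (c *: a).
Proof.
move=> [/bop_bounded_op ba [f hf aE]]; split.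
  by apply/bop_bounded_op; exact: bop_scale.
have oo1 : (1 <= +oo :> \bar R)%E by exact: leey.
have c0 : cLfun mu +oo%E (fun=> (0 : R)%:C).
  by apply: cLfunoo_real => // x; rewrite normr0.
exists (fun x => c * f x + (0 : R)%:C); first exact: cLfun_lin.
move=> g hg; rewrite fctE aE //.
have z : cL2 (fun=> 0) := cLfun_cst 0.
have z0 : cls (fun=> 0) = 0.
  rewrite -[RHS](subrr (cls (fun=> 0))) -classB //.
  by congr L2_class; apply/funext => x; rewrite subrr.
have := L2_class_linear L c (cLfun_mul hf hg) z; rewrite z0 addr0 => <-.
by congr L2_class; apply/funext => x; rewrite !addr0 mulrA.
Qed.

Lemma class1_neq0 : cls (fun=> 1) != 0.
Proof.
apply/eqP => h; have := nn_class (cLfun_cst 1); rewrite h nn0.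
rewrite (@eq_Rintegral _ _ _ mu setT (fun=> 1)) => [|x _]; last first.
  by rewrite /= expr1n expr0n addr0.
rewrite Rintegral_cst // [X in fine X](_ : _ = 1%E); last exact: probability_setT.
by rewrite mul1r => /esym/eqP; rewrite oner_eq0.
Qed.

(** The test function is v = 1 where w >= 0 and -1 elsewhere, so v w = |w|; finiteness of the
    measure makes w integrable. *)
Lemma sign_integral w : w \in Lfun mu 2%:E ->
  (forall v, measurable_fun setT v -> (forall x, `|v x| <= 1) ->
     \int[mu]_x (v x * w x) = 0) ->
  w = (fun=> 0) %[ae mu].
Proof.
move=> hw h; have mw := Lfun_measurable hw.
pose E := [set x | 0 <= w x].
have mE : measurable E.
  have -> : E = setT `&` w @^-1` `[0, +oo[%classic.
    by rewrite setTI; apply/seteqP; split=> x; rewrite /E /= in_itv /= andbT.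
  by apply: mw => //; exact: measurable_itv.
pose v x : R := 2 * \1_E x - 1.
have mv : measurable_fun setT v.
  apply: (@measurable_funB _ _ _ _ (fun x => 2 * \1_E x) (fun=> 1)).
    by apply: measurable_funM; [exact: measurable_cst|exact: measurable_indic].
  exact: measurable_cst.
have vE x : v x = if 0 <= w x then 1 else - 1.
  have xE : (x \in E) = (0 <= w x) by apply/idP/idP; rewrite inE.
  rewrite /v indicE xE; case: ifP => _ /=.
    by rewrite mulr1 -[2]/(1 + 1) addrK.
  by rewrite mulr0 sub0r.
have v1 x : `|v x| <= 1 by rewrite vE; case: ifP => _; rewrite ?normrN normr1.
have vw x : v x * w x = `|w x|.
  rewrite vE; case: (leP 0 (w x)) => w0; first by rewrite mul1r ger0_norm.
  by rewrite mulN1r ltr0_norm.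
have iw : mu.-integrable setT (EFin \o w).
  have fm : (mu : {measure set T -> \bar R}) setT \is a fin_num.
    by rewrite [X in X \is a _](_ : _ = 1%E) //; exact: probability_setT.
  by apply/Lfun1_integrable; exact: (Lfun_subset12 fm hw).
have := h v mv v1; rewrite (@eq_Rintegral _ _ _ mu setT (fun x => `|w x|)); last first.
  by move=> x _; exact: vw.
rewrite /Rintegral => /eqP; rewrite fine_eq0; last first.
  by apply: integrable_fin_num => //; exact: (integrable_abse iw).
move=> /eqP i0.
have := (ae_eq_integral_abs mu measurableT (_ : measurable_fun setT (EFin \o w))).1.
move=> /(_ _ i0) hae.
have {}hae := hae (proj2 (measurable_EFinP _ _) mw).
by apply: filterS hae => x /= hx _; have /eqP := hx I; rewrite eqe => /eqP.
Qed.

Lemma class_ae0 f : cL2 f -> (fun x => complex.Re (f x)) = (fun=> 0) %[ae mu] ->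
  (fun x => complex.Im (f x)) = (fun=> 0) %[ae mu] -> cls f = 0.
Proof.
move=> hf h1 h2; apply: nn_eq0; rewrite nn_class // /Rintegral.
rewrite (@ae_eq_integral _ _ _ mu setT (cst 0%E)) ?integral0 //.
- by case/integrableP: (integrable_sqr hf).
- apply: filterS2 h1 h2 => x /= h1 h2 _.
  by rewrite (h1 I) (h2 I) expr0n /= addr0.
Qed.

(** The inner product of the class of v with that of f integrates v times the conjugate of f; its
    real and imaginary parts test Re f against v and Im f against -v. *)
Lemma class1_cyclic (h : L) :
  (forall b, Linfty L b -> inner (b (cls (fun=> 1))) h = 0) -> h = 0.
Proof.
have [f hf <-] := L2_class_surj h => hb.
have key v : measurable_fun setT v -> (forall x, `|v x| <= 1) ->
    \int[mu]_x (v x * complex.Re (f x)) = 0 /\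
    \int[mu]_x (- v x * complex.Im (f x)) = 0.
  move=> mv v1; have [b [Lb bE]] := mult_op mv v1.
  have h1 := cLfun_cst 1; have := hb b Lb; rewrite bE // L2_class_inner //; last first.
    exact: cLfun_mul (cLfunoo_real mv v1) h1.
  rewrite /cintegral => e.
  have e1 := congr1 (@complex.Re R) e; have e2 := congr1 (@complex.Im R) e.
  split.
    by rewrite -[RHS]e1 /=; apply: eq_Rintegral => x _; case: (f x) => a b' /=; ring.
  by rewrite -[RHS]e2 /=; apply: eq_Rintegral => x _; case: (f x) => a b' /=; ring.
move/cLfunP: (hf) => [hr hi].
apply: class_ae0 => //; apply: sign_integral => // v mv v1.
  by case: (key v mv v1).
have [||_] := key (fun x => - v x).
- exact: measurableT_comp.
- by move=> x; rewrite normrN.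
- by move=> <-; apply: eq_Rintegral => x _; rewrite opprK.
Qed.

End MultiplicationAlgebra.

(** * Transfer of generators from P to Q *)

Theorem theorem19 (R : realType) (d : measure_display) (T : measurableType d)
    (mu : probability T R) (L : L2space mu)
    (H K : hilbertType R) (P : set (H -> H)) (Q : set (K -> K))
    (LH : hilbert_tensor L H) (LK : hilbert_tensor L K) (kappa : Type)
    (P_vn : is_vonNeumann P) (Q_vn : is_vonNeumann Q)
    (L_sep : vn_separable (Linfty L))
    (iso : vn_isomorphic (vn_tensor LH (Linfty L) P)
                         (vn_tensor LK (Linfty L) Q))
    (kappa_inf : infinite_set [set: kappa])
    (P_gen : generated_by kappa P) :
  generated_by kappa Q.
Proof.
have [S [_ Sk SE]] := P_gen; have [theta thetaP] := iso.
have Lb := @Linfty_bounded _ _ _ _ L; have Lid := @Linfty_id _ _ _ _ L.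
have [a [La asep]] := separating_sequence Lb Lid (@Linfty_scale _ _ _ _ L) L_sep.
have [f [g [GM GE]]] := tensor_generated LH Lb Lid P_vn La asep SE.
have NE := vn_iso_generated (vn_tensor_vn LH (Linfty L) P)
  (vn_tensor_vn LK (Linfty L) Q) thetaP GM GE.
pose one := L2_class L (fun=> 1%R); pose X n := a n one.
have tX : total_set (range X).
  move=> h hX; apply: class1_cyclic => b Lb'.
  (* Separation is applied with a zero second functional: a vector orthogonal to all a_n 1 is
     orthogonal to A 1. *)
  rewrite -(inner0r (b one)); apply: asep => // n.
  by rewrite inner0r; apply: hX; exists n.
have WE := slices_generate Lid Q_vn (class1_neq0 L) tX NE.
set W := (W in vn_generated W) in WE.
exists W; split=> //; first by rewrite -WE; exact: sub_vn_generated.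
have [k0 _] := infinite_setN0 kappa_inf.
have [e Se] := card_le_surj k0 id Sk.
(* In (i, j, m) the first two entries select the vectors; m = 0 selects the generator from the
   element e k of [S], and m = m' + 1 the generator f m', for which k is arbitrary. *)
pose code n : nat * nat * nat := odflt (0, 0, 0)%N (unpickle n).
pose h (p : nat * kappa) := let: (i, j, m) := code p.1 in
  slice (fun x y => tensor LK x y) (X i) (X j)
    (theta (if m is m'.+1 then f m' else g (e p.2))).
apply: (card_le_range (h := h) kappa_inf).
move=> _ [xi [eta [t [[i _ <-] [j _ <-] [c Gc <-] ->]]]].
case: Gc => [[m _ <-]|[s /Se [k _ <-] <-]].
  by exists (pickle (i, j, m.+1), k0); rewrite // /h /code pickleK.
by exists (pickle (i, j, 0%N), k); rewrite // /h /code pickleK.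
Qed.
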